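(* Let $X\subset(0,1)^n$ be a set of dimension $\dim X<n$ that has a $(J,A,C)$-mild parametrization. There exist effectively computable constants $C_1,C_2,C_3$, depending only on $J,A,C,n$ and $\dim X$, such that for every number field $K\subset\mathbb{R}$ with $d=[K:\mathbb{Q}]$ and every $T\ge e$, the set $X(K,T)$ is contained in the union of at most $C_1d^{C_2}(\log T)^{C_3}$ algebraic hypersurfaces of degree bounded by $(d^2\log T)^{\dim X/(n-\dim X)}$.
   Context: Mild parametrization: a set $X\subset\mathbb{R}^n$ of dimension $k$ has a $(J,A,C)$-mild parametrization if it is covered by the images of $J$ maps that are $C^\infty$ on the unit cube $(0,1)^k$ with values in $\mathbb{R}^n$, and each coordinate function $\phi$ of these maps satisfies $|\partial^\mu\phi(z)|\le \mu!\,(A|\mu|^C)^{|\mu|}$ for all multi-indices $\mu\in\mathbb{N}^k$ and all $z$ in the cube. Here $|\mu|=\mu_1+\dots+\mu_k$, $\mu!=\mu_1!\cdots\mu_k!$, and the bound for $\mu=0$ is read as $1$. $X(K,T)$ denotes the set of points of $X$ all of whose coordinates lie in $K$ and whose absolute multiplicative Weil height is at most $T$; the height of a tuple is the maximum of the heights of its coordinates. *)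

(* Defs.v *)
From HB Require Import structures.
From mathcomp Require Import all_boot all_order all_algebra all_field.
From mathcomp Require Import all_classical all_reals all_analysis.
(* The notations of mpoly clash with those of the analysis library. *)
From mathcomp Require Import -(notations) mpoly.
From mathcomp Require Import complex.

Set Implicit Arguments.
Unset Strict Implicit.
Unset Printing Implicit Defensive.

Import Order.TTheory GRing.Theory Num.Theory.
Import numFieldNormedType.Exports.

Local Open Scope classical_set_scope.
Local Open Scope ring_scope.

(* Kleene's total recursive functions: [rec_min] requires every search to
   succeed.  Specifying the functions pointwise makes the predicate
   extensional. *)
Inductive recursive : forall m : nat, (m.-tuple nat -> nat) -> Prop :=
| rec_zero m (h : m.-tuple nat -> nat) :
    (forall v, h v = 0%N) -> recursive h
| rec_succ (h : 1.-tuple nat -> nat) :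
    (forall v, h v = (thead v).+1) -> recursive h
| rec_proj m (i : 'I_m) (h : m.-tuple nat -> nat) :
    (forall v, h v = tnth v i) -> recursive h
| rec_comp m p (f : p.-tuple nat -> nat) (g : 'I_p -> m.-tuple nat -> nat)
      (h : m.-tuple nat -> nat) :
    recursive f -> (forall i, recursive (g i)) ->
    (forall v, h v = f [tuple g i v | i < p]) -> recursive h
| rec_prim m (f : m.-tuple nat -> nat) (g : m.+2.-tuple nat -> nat)
      (h : m.+1.-tuple nat -> nat) :
    recursive f -> recursive g ->
    (forall v : m.-tuple nat, h [tuple of 0%N :: v] = f v) ->
    (forall i (v : m.-tuple nat),
      h [tuple of i.+1 :: v] = g [tuple of i :: h [tuple of i :: v] :: v]) ->
    recursive h
| rec_min m (f : m.+1.-tuple nat -> nat) (h : m.-tuple nat -> nat) :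
    recursive f ->
    (forall v : m.-tuple nat, f [tuple of h v :: v] = 0%N) ->
    (forall (v : m.-tuple nat) y,
      (y < h v)%N -> f [tuple of y :: v] <> 0%N) ->
    recursive h.

Section Mild.
Variable R : realType.

Definition unit_cube (k : nat) : set 'rV[R]_k :=
  [set z | forall i, 0 < z ord0 i < 1].

(* [iter_partial [:: i1; ...; ir] f] is d_i1 (d_i2 (... (d_ir f))). *)
Definition iter_partial (k : nat) (s : seq 'I_k) (f : 'rV[R]_k -> R) :
    'rV[R]_k -> R :=
  foldr (fun i g z => 'D_('e_i) g z) f s.

(* All partial derivatives of all orders exist and are continuous on the cube;
   [f] is total on R^k, but its values outside the open cube are irrelevant. *)
Definition smooth_on_cube (k : nat) (f : 'rV[R]_k -> R) : Prop :=
  forall (s : seq 'I_k) (z : 'rV[R]_k), unit_cube z ->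
    {for z, continuous (iter_partial s f)} /\
    forall i, derivable (iter_partial s f) z 'e_i.

Definition multi_partial (k : nat) (mu : 'I_k -> nat) (f : 'rV[R]_k -> R) :
    'rV[R]_k -> R :=
  iter_partial (flatten [seq nseq (mu i) i | i <- enum 'I_k]) f.

(* For mu = 0 the right-hand side is 1, because x ^+ 0 = 1 for every x. *)
Definition mild_bound (k : nat) (A C : R) (f : 'rV[R]_k -> R) : Prop :=
  forall (mu : 'I_k -> nat) (z : 'rV[R]_k), unit_cube z ->
    let m := (\sum_i mu i)%N in
    `|multi_partial mu f z|
      <= ((\prod_i (mu i)`!)%N)%:R * (A * m%:R `^ C) ^+ m.

(* The parameter k stands for dim X, which intervenes only as the dimension of
   the cube.  The images cover X; they need not be contained in X. *)
Definition mild_parametrization (n k J : nat) (A C : R) (X : set 'rV[R]_n) :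
    Prop :=
  exists Phi : 'I_J -> 'rV[R]_k -> 'rV[R]_n,
    (forall j i, smooth_on_cube (fun z => Phi j z ord0 i) /\
                 mild_bound A C (fun z => Phi j z ord0 i)) /\
    X `<=` \bigcup_j (Phi j @` @unit_cube k).

End Mild.

Section Height.
Variables (R : realType) (K : fieldExtType rat).

(* Normalized absolute value |x|_v = N(P)^(- ord_P(x)) of a prime P of the ring
   of integers: an ultrametric absolute value whose residue field has finite
   cardinality q ([r] is a system of representatives) and for which the largest
   value below 1, that of a uniformizer, is 1/q.  This is the power
   [K_v : Q_v] of the extension to K of the p-adic absolute value of Q, and
   there is exactly one such function for each finite place. *)
Definition finite_place (v : K -> R) : Prop :=
  [/\ v 0 = 0,
      forall x, x != 0 -> 0 < v x,
      forall x y, v (x * y) = v x * v y,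
      forall x y, v (x + y) <= Num.max (v x) (v y) &
      exists (q : nat) (r : 'I_q -> K) (pi : K),
        [/\ forall i, v (r i) <= 1,
            forall x, v x <= 1 -> exists! i, v (x - r i) < 1,
            v pi = q%:R^-1 &
            forall x, v x < 1 -> v x <= v pi]].

Definition complex_embedding (s : K -> R[i]) : Prop :=
  exists f : {rmorphism K -> R[i]}, s = f.

(* A complex place gives two conjugate embeddings, hence its local degree 2.
   Both products have finite support. *)
Definition weil_height (x : K) : R :=
  ((\big[*%R/1]_(s \in [set s | complex_embedding s])
      Num.max 1 (complex.Re `|s x|)) *
   (\big[*%R/1]_(v \in [set v | finite_place v])
      Num.max 1 (v x))) `^ (\dim {:K})%:R^-1.

Definition tuple_height (n : nat) (y : 'rV[K]_n) : R :=
  \big[Num.max/0]_(i < n) weil_height (y ord0 i).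

(* The subfield K of R is given by its inclusion [iota]. *)
Definition points_of_height (n : nat) (iota : {rmorphism K -> R})
    (X : set 'rV[R]_n) (T : R) : set 'rV[R]_n :=
  X `&` [set map_mx iota y | y in [set y : 'rV[K]_n | tuple_height y <= T]].

End Height.

Section Hypersurface.
Variables (R : realType) (n : nat).

(* [msize p] is the total degree plus one. *)
Definition hypersurface_le (D : R) (S : set 'rV[R]_n) : Prop :=
  exists p : mpoly.mpoly n R,
    [/\ (1 < mpoly.msize p)%N,
        (mpoly.msize p).-1%:R <= D &
        S = [set x | mpoly.meval (fun i => x ord0 i) p = 0]].

End Hypersurface.

(* Main.v *)
Require Import Defs.
From HB Require Import structures.
From mathcomp Require Import all_boot all_order all_algebra all_field.
From mathcomp Require Import all_classical all_reals all_analysis.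
From mathcomp Require Import -(notations) mpoly.
From mathcomp Require Import complex.
From mathcomp Require Import perm zify ring lra.

Set Implicit Arguments.
Unset Strict Implicit.
Unset Printing Implicit Defensive.

Import Order.TTheory GRing.Theory Num.Theory.
Import numFieldNormedType.Exports.

Local Open Scope classical_set_scope.
Local Open Scope ring_scope.

(** The proof is the determinant method.  Put [E = d^2 ln T], and let [D >= 1]
    be the integer part of [E ^ (k / (n - k))].  The unit cube parametrizing [X]
    is cut into small boxes, and on the image of every box the points of height
    at most [T] are shown to lie on one hypersurface of degree at most [D]; it
    then remains to count the boxes.

    Let [L] be the number of monomials of degree at most [D] in [n] variables,
    about [D ^ n].  If the determinant of these monomials at any [L] of the
    points vanishes, some nonzero combination of the monomials vanishes at all of
    them ([vanishing_hypersurface]).  A nonzero determinant would be both too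
    small and too large.

    Upper bound ([det_monomials_upper_bound]).  Truncating Taylor expansions at
    the order [beta] writes each monomial on a box as a polynomial of degree less
    than [beta] in the [k] parameters plus a remainder.  These polynomials span
    at most [beta ^ k] dimensions, and [beta] is chosen with [2 beta ^ k <= L].
    In the expansion of the determinant at least [L / 2] of the factors of every
    nonzero term are therefore remainders ([det_perturbed_low_rank]).  Mildness
    makes a remainder at most [2 delta ^ beta] as soon as the boxes have size
    [1 / M] with [M] of the order of [D beta ^ c / delta].

    Lower bound ([det_monomials_lower_bound]).  A point [x] of [K] of height at
    most [T] has an integer denominator [a], and [a] times the archimedean part
    of the height is at most [T ^ d]: the product of the values greater than 1 of
    [x] at the finite places is such a denominator ([height_denominator]).
    Clearing denominators in each row turns the determinant into an algebraic
    integer, whose norm is at least 1 in absolute value ([norm_ge1]).  Using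
    denominators in the rational integers is what costs [d^2] instead of [d].

    The two bounds contradict each other because [D E] is at most a constant
    times [beta] ([degree_order]), so that a constant [delta] suffices
    ([contradictory_bounds]).

    The arithmetic input is that an element of value at most 1 at every finite
    place is integral over the rational integers ([integral_of_places]): if [y]
    is not integral, a maximal subring containing [1 / y] but not [y] is a
    valuation ring [V], and [x |-> 1 / #(V / x V)] extends to a finite place at
    which [y] has value greater than 1.  That only finitely many places matter
    for a given element follows from the approximation theorem. *)

(** * Closure properties of the total recursive functions *)

Lemma recursive_const m (q : nat) : recursive (fun _ : m.-tuple nat => q).
Proof.
elim: q => [|q IH]; first exact: rec_zero.
apply: (@rec_comp m 1 (fun v => (thead v).+1) (fun _ _ => q)) => //.
- exact: rec_succ (fun=> erefl).
- by move=> v; rewrite /thead tnth_mktuple.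
Qed.

Lemma recursive_succ m (g : m.-tuple nat -> nat) :
  recursive g -> recursive (fun v => (g v).+1).
Proof.
move=> rg; apply: (@rec_comp m 1 (fun v => (thead v).+1) (fun _ => g)) => //.
- exact: rec_succ (fun=> erefl).
- by move=> v; rewrite /thead tnth_mktuple.
Qed.

Lemma recursive_comp2 m (f : nat -> nat -> nat) (g1 g2 : m.-tuple nat -> nat) :
  recursive (fun v : 2.-tuple nat => f (tnth v ord0) (tnth v ord_max)) ->
  recursive g1 -> recursive g2 -> recursive (fun v => f (g1 v) (g2 v)).
Proof.
move=> rf r1 r2.
apply: (rec_comp (g := fun i => if i == ord0 then g1 else g2) rf) => //.
- by move=> i; case: ifP.
- by move=> v; rewrite !tnth_mktuple.
Qed.

(** The recursion on the first argument that produces sums, products and powers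
    from each other has a step depending only on the previous value and on the
    second argument. *)
Lemma recursive_iter (f : nat -> nat) (g : nat -> nat -> nat) :
  recursive (fun v : 1.-tuple nat => f (tnth v ord0)) ->
  recursive (fun v : 2.-tuple nat => g (tnth v ord0) (tnth v ord_max)) ->
  recursive (fun v : 2.-tuple nat =>
    iter (tnth v ord0) (g^~ (tnth v ord_max)) (f (tnth v ord_max))).
Proof.
move=> rf rg.
have r3 : recursive (fun v : 3.-tuple nat =>
    g (tnth v (inord 1)) (tnth v ord_max)).
  exact: (recursive_comp2 rg (rec_proj (i := inord 1) (fun=> erefl))
                             (rec_proj (i := ord_max) (fun=> erefl))).
apply: (rec_prim rf r3).
- by move=> v; rewrite !(tnth_nth 0%N).
- by move=> i v; rewrite !(tnth_nth 0%N) /= inordK.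
Qed.

Lemma recursive_add m (g1 g2 : m.-tuple nat -> nat) :
  recursive g1 -> recursive g2 -> recursive (fun v => g1 v + g2 v)%N.
Proof.
apply: (recursive_comp2 (f := addn)).
have -> : (fun v : 2.-tuple nat => tnth v ord0 + tnth v ord_max)%N =
    (fun v => iter (tnth v ord0) (fun x => x.+1) (tnth v ord_max)).
  by apply/funext => v; elim: (tnth v ord0) => //= n <-.
apply: (recursive_iter (f := id) (g := fun x _ => x.+1)).
- exact: rec_proj.
- by apply: recursive_succ; apply: rec_proj.
Qed.

Lemma recursive_mul m (g1 g2 : m.-tuple nat -> nat) :
  recursive g1 -> recursive g2 -> recursive (fun v => g1 v * g2 v)%N.
Proof.
apply: (recursive_comp2 (f := muln)).
have -> : (fun v : 2.-tuple nat => tnth v ord0 * tnth v ord_max)%N =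
    (fun v => iter (tnth v ord0) (fun x => x + tnth v ord_max) 0)%N.
  by apply/funext => v; elim: (tnth v ord0) => //= n <-; rewrite mulSn addnC.
apply: (recursive_iter (f := fun=> 0%N) (g := addn)).
- exact: recursive_const.
- by apply: recursive_add; apply: rec_proj.
Qed.

Lemma recursive_exp m (g1 g2 : m.-tuple nat -> nat) :
  recursive g1 -> recursive g2 -> recursive (fun v => g1 v ^ g2 v)%N.
Proof.
move=> r1 r2; apply: (recursive_comp2 (f := fun x y => y ^ x)%N) r2 r1.
have -> : (fun v : 2.-tuple nat => tnth v ord_max ^ tnth v ord0)%N =
    (fun v => iter (tnth v ord0) (fun x => x * tnth v ord_max) 1)%N.
  by apply/funext => v; elim: (tnth v ord0) => //= n <-; rewrite expnSr.
apply: (recursive_iter (f := fun=> 1%N) (g := muln)).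
- exact: recursive_const.
- by apply: recursive_mul; apply: rec_proj.
Qed.

(** * Two facts on determinants *)

(** A maximal linearly independent family of elements of [S] has fewer than
    [L] elements, so some nonzero linear form vanishes on it, hence on [S]. *)
Lemma exists_vanishing_form (F : fieldType) L (S : set 'rV[F]_L) :
  (forall B : 'M[F]_L, (forall i, S (row i B)) -> \det B = 0) ->
  exists2 c : 'cV[F]_L, c != 0 & forall v, S v -> v *m c = 0.
Proof.
move=> detS; apply: contrapT => noform.
have free m : (m <= L)%N ->
    exists2 B : 'M[F]_(m, L), forall i, S (row i B) & row_free B.
  elim: m => [|m IH] lemL.
    by exists 0 => [[]//|]; rewrite /row_free mxrank0.
  have [B SB freeB] := IH (ltnW lemL).
  have [sub|/existsNP[v /not_implyP[Sv /negP vB]]] :=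
    pselect (forall v, S v -> (v <= B)%MS).
    case: noform; have : cokermx B != 0.
      by rewrite -mxrank_eq0 mxrank_coker (eqP freeB) subn_eq0 -ltnNge.
    move=> /eqP /matrixP /= nz.
    have [j nzj] : exists j, col j (cokermx B) != 0.
      apply: contrapT => /forallNP allz; apply: nz => i j.
      by have /negP := allz j; rewrite negbK => /eqP/colP/(_ i); rewrite !mxE.
    exists (col j (cokermx B)) => // w Sw.
    have := sub _ Sw; rewrite submxE => /eqP wB.
    by rewrite colE mulmxA wB mul0mx.
  rewrite -[m.+1]addn1.
  exists (col_mx B v).
    move=> i; case: (fintype.splitP i) => j ij.
      have -> : i = lshift 1 j by apply: val_inj.
      by rewrite rowKu.
    have -> : i = rshift m j by apply: val_inj.
    by rewrite rowKd ord1 row_id.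
  rewrite /row_free eqn_leq rank_leq_row /= -addsmxE.
  have lt : (B < B + v)%MS.
    by rewrite ltmxE addsmxSl /= addsmx_sub submx_refl.
  by rewrite addn1 -[X in (X < _)%N](eqP freeB) ltmxErank in lt *; case/andP: lt.
have [B SB] := free L (leqnn L).
by rewrite row_free_unit unitmxE unitfE detS ?eqxx.
Qed.

(** The rows in [J] lie in the row space of [V], of dimension at most [N]. *)
Lemma det_low_rank (F : fieldType) L N (U : 'M[F]_(L, N)) (V : 'M[F]_(N, L))
    (B : 'M[F]_L) (J : {set 'I_L}) :
  (N < #|J|)%N -> (forall i, i \in J -> row i B = row i (U *m V)) ->
  \det B = 0.
Proof.
move=> ltN eqB; apply/eqP; apply: contraTT ltN => detB; rewrite -leqNgt.
have freeB : row_free B by rewrite row_free_unit unitmxE unitfE.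
pose f (i : 'I_#|J|) : 'I_L := enum_val i.
have eqf : rowsub f B = rowsub f U *m V.
  apply/row_matrixP => i.
  by rewrite row_rowsub eqB ?enum_valP // !row_mul row_rowsub.
have : row_free (rowsub f B).
  rewrite -[B]mul1mx -mul_rowsub_mx /row_free mxrankMfree //.
  apply/eqP/anti_leq; rewrite rank_leq_row /=.
  have sel1 : rowsub f 1%:M *m (rowsub f 1%:M)^T = 1%:M :> 'M[F]_#|J|.
    apply/matrixP => i j; rewrite !mxE (bigD1 (f i)) //= !mxE eqxx mul1r.
    rewrite big1 ?addr0 => [|l nl]; last by rewrite !mxE eq_sym (negPf nl) mul0r.
    by rewrite eq_sym (inj_eq enum_val_inj) eq_sym.
  by rewrite -[X in (X <= _)%N](mxrank1 F) -sel1 mxrankM_maxl.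
rewrite /row_free => /eqP <-; rewrite eqf.
by apply: leq_trans (mxrankM_maxl _ _) (rank_leq_col _).
Qed.

Lemma det_bound (R : numDomainType) L (B : 'M[R]_L) (b : 'I_L -> R) :
  (forall i j, `|B i j| <= b i) -> `|\det B| <= (L`!)%:R * \prod_i b i.
Proof.
move=> leB; apply: le_trans (ler_norm_sum _ _ _) _.
have -> : (L`!)%:R * \prod_i b i = \sum_(s : 'S_L) \prod_i b i :> R.
  by rewrite sumr_const card_Sn mulr_natl.
apply: ler_sum => s _; rewrite normrM normrX normrN1 expr1n mul1r normr_prod.
by apply: ler_prod => i _; rewrite normr_ge0 leB.
Qed.

(** Expand the determinant along the subsets [J] of rows taken from [U *m V]:
    the terms with more than [N] such rows vanish, and every other one has at
    least [L - N] small rows. *)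
Lemma det_perturbed_low_rank (R : realFieldType) L N (U : 'M[R]_(L, N))
    (V : 'M[R]_(N, L)) (Q : 'M[R]_L) (rho : R) :
  0 <= rho <= 1 ->
  (forall i j, `|(U *m V) i j| <= 2) -> (forall i j, `|Q i j| <= rho) ->
  `|\det (U *m V + Q)| <= 4 ^+ L * (L`!)%:R * rho ^+ (L - N).
Proof.
move=> /andP[rho0 rho1] leP leQ; set P := U *m V in leP *.
pose B (J : {set 'I_L}) := \matrix_(i, j) (if i \in J then P i j else Q i j).
have -> : \det (P + Q) = \sum_J \det (B J).
  rewrite exchange_big /=; apply: eq_bigr => s _; rewrite -big_distrr /=.
  congr (_ * _); under eq_bigr do rewrite mxE.
  rewrite bigA_distr; apply: eq_bigr => J _; apply: eq_bigr => i _.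
  by rewrite !mxE.
apply: le_trans (ler_norm_sum _ _ _) _.
have -> : 4 ^+ L * (L`!)%:R * rho ^+ (L - N) =
    \sum_(J : {set 'I_L}) 2 ^+ L * (L`!)%:R * rho ^+ (L - N) :> R.
  rewrite sumr_const -cardsT -powersetT card_powerset cardsT card_ord.
  rewrite -[4](_ : 2 * 2 = _) ?exprMn; last by ring.
  by rewrite -[RHS]mulr_natl natrX !mulrA.
apply: ler_sum => J _; have [ltN|leN] := ltnP N #|J|.
  rewrite (det_low_rank ltN (U := U) (V := V)); last first.
    by move=> i iJ; apply/rowP => j; rewrite !mxE iJ.
  by rewrite normr0 !mulr_ge0 ?exprn_ge0 ?ler0n.
have := @det_bound _ _ (B J) (fun i => if i \in J then 2 else rho).
move=> /(_ _)/le_trans -> //.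
  by move=> i j; rewrite mxE; case: ifP.
rewrite [2 ^+ L * _]mulrC -mulrA; apply: ler_wpM2l; first exact: ler0n.
rewrite (bigID (mem J)) /= (eq_bigr (fun=> 2)); last by move=> i ->.
rewrite [X in _ * X](eq_bigr (fun=> rho)); last by move=> i /negPf->.
rewrite !prodr_const; apply: ler_pM; rewrite ?exprn_ge0 //.
  by apply: ler_weXn2l; rewrite ?ler1n // -[X in (_ <= X)%N]card_ord max_card.
apply: ler_wiXn2l => //.
by rewrite leq_subLR -[X in (X <= _)%N](card_ord L) -(cardC J) leq_add2r.
Qed.

(** * Algebraic numbers and rational integers *)

Section IntegerRelations.
Variable K : fieldExtType rat.
Implicit Types x y : K.

Lemma intr_eq0K (c : int) : (c%:~R == 0 :> K) = (c == 0).
Proof. by rewrite -(rmorph_int (in_alg K)) fmorph_eq0 intr_eq0. Qed.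

Lemma exists_int_poly x :
  exists2 q : {poly int}, q != 0 & root (map_poly intr q) x.
Proof.
have /polyOver1P[p pE] : minPoly 1%VS x \is a polyOver 1%VS.
  exact: minPolyOver.
have p0 : p != 0.
  by rewrite -(map_poly_eq0 (in_alg K)) -pE monic_neq0 ?monic_minPoly.
have [q [a a0 qE]] := rat_poly_scale p; exists q.
  by apply: contraNneq p0 => q0; rewrite qE q0 map_poly0 scaler0.
have := root_minPoly 1%VS x; rewrite pE qE map_polyZ rootZ; last first.
  by rewrite fmorph_eq0 invr_eq0 intr_eq0.
rewrite -map_poly_comp => /eqP rx; apply/eqP; rewrite -[RHS]rx.
by congr (_.[x]); apply: eq_map_poly => c; rewrite /= scaler_int.
Qed.

(** Take for [c] the lowest nonzero coefficient of an integral polynomial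
    vanishing at [x].  Hence [x] divides a nonzero integer in every subring that
    contains it. *)
Lemma exists_int_multiple x : x != 0 ->
  exists (c : int) (g : {poly int}),
    c != 0 /\ c%:~R = x * (map_poly intr g).[x].
Proof.
move=> x0; have [q] := exists_int_poly x.
elim/poly_ind: q => [|q c IH]; first by rewrite eqxx.
have rE : root (map_poly intr (q * 'X + c%:P)) x =
    ((map_poly intr q).[x] * x + c%:~R == 0).
  by rewrite /root rmorphD rmorphM /= map_polyX map_polyC !hornerE.
rewrite rE; have [->|c0] := eqVneq c 0.
  rewrite !addr0 => q0; rewrite mulf_eq0 (negPf x0) orbF => rq.
  by apply: IH => //; apply: contraNneq q0 => ->; rewrite mul0r.
move=> _ /eqP eq0; exists c, (- q); split => //.
by rewrite rmorphN hornerN mulrN mulrC -[RHS]addr0 -eq0 addKr.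
Qed.

Lemma exists_int_relation m (e : 'I_m -> K) : (\dim {:K} < m)%N ->
  exists2 c : 'I_m -> int, \sum_i (c i)%:~R * e i = 0 & exists i, c i != 0.
Proof.
case: m e => // m e ltm; pose X := [tuple e i | i < m.+1].
have : ~~ free X.
  apply: contraTN ltm => /eqP dimX; rewrite -leqNgt -(size_tuple X) -dimX.
  exact: dimvS (subvf _).
move=> /freeP nfree.
have [k [kX [i0 ki0]]] : exists k : 'I_m.+1 -> rat,
    \sum_i k i *: X`_i = 0 /\ exists i, k i != 0.
  apply: contrapT => nok; apply: nfree => k kX i; apply: contrapT => /eqP ki.
  by apply: nok; exists k; split=> //; exists i.
have [q [a a0 qE]] := rat_poly_scale (\poly_(i < m.+1) k (inord i)).
have kE (i : 'I_m.+1) : (q`_i)%:~R = a%:~R * k i :> rat.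
  have := congr1 (fun p : {poly rat} => p`_i) qE.
  rewrite /= coef_poly ltn_ord inord_val coefZ coef_map => ->.
  by rewrite mulVKf ?intr_eq0.
exists (fun i => q`_i).
  transitivity (a%:~R *: (\sum_i k i *: X`_i) : K); last by rewrite kX scaler0.
  rewrite scaler_sumr; apply: eq_bigr => i _.
  rewrite scalerA -kE (nth_map i) ?size_enum_ord // nth_ord_enum.
  by rewrite scaler_int mulrzl.
by exists i0; rewrite -(intr_eq0 rat) kE mulf_neq0 ?intr_eq0.
Qed.

(** Divide a relation by [p] as long as possible. *)
Lemma exists_primitive_int_relation (p : nat) m (e : 'I_m -> K) :
  prime p -> (\dim {:K} < m)%N ->
  exists2 c : 'I_m -> int,
    \sum_i (c i)%:~R * e i = 0 & exists i, ~~ (p%:Z %| c i)%Z.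
Proof.
move=> pr_p /exists_int_relation -/(_ e)[c].
have [s] := ubnP (\sum_i `|c i|)%N; elim: s c => // s IH c.
rewrite ltnS => les rel [i0 ci0].
have [alldvd|/existsNP[i /negP ndvd]] := pselect (forall i, (p%:Z %| c i)%Z);
  last by exists c => //; exists i.
pose c' i := (c i %/ p%:Z)%Z.
have cE i : c i = c' i * p%:Z by rewrite divzK.
have c'i0 : c' i0 != 0 by apply: contraNneq ci0 => c'0; rewrite cE c'0 mul0r.
apply: (IH c').
- have lt0 : (`|c' i0| < `|c i0|)%N.
    by rewrite cE abszM ltn_Pmulr ?absz_gt0 ?prime_gt1.
  apply: leq_trans les; rewrite (bigD1 i0) //= [X in (_ < X)%N](bigD1 i0) //=.
  rewrite -addSn leq_add //; apply: leq_sum => i _.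
  by rewrite cE abszM leq_pmulr ?prime_gt0.
- apply/eqP; move/eqP: rel; rewrite (_ : \sum_i _ =
      (p%:Z)%:~R * \sum_i (c' i)%:~R * e i).
    by rewrite mulf_eq0 intr_eq0K; case: (p) pr_p.
  rewrite big_distrr /=; apply: eq_bigr => i _.
  by rewrite cE intrM mulrA [(c' i)%:~R * _]mulrC.
- by exists i0.
Qed.

End IntegerRelations.

(** * Valuation rings of a number field *)

Section ValuationRing.
Variables (K : fieldExtType rat) (V : set K).
Implicit Types x y z : K.

Definition subring_set := [/\ V 1, forall x y, V x -> V y -> V (x - y) &
  forall x y, V x -> V y -> V (x * y)].

Hypothesis ringV : subring_set.

Let V1 : V 1. Proof. by case: ringV. Qed.
Lemma subring_B x y : V x -> V y -> V (x - y).
Proof. by case: ringV => _ + _; apply. Qed.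
Lemma subring_M x y : V x -> V y -> V (x * y).
Proof. by case: ringV => _ _; apply. Qed.
Lemma subring_0 : V 0.
Proof. by rewrite -(subrr 1); apply: subring_B. Qed.
Lemma subring_N x : V x -> V (- x).
Proof. by rewrite -sub0r => Vx; apply: subring_B => //; apply: subring_0. Qed.
Lemma subring_D x y : V x -> V y -> V (x + y).
Proof. by move=> Vx Vy; rewrite -[y]opprK; apply/subring_B/subring_N. Qed.
Lemma subring_sum (I : finType) (F : I -> K) :
  (forall i, V (F i)) -> V (\sum_i F i).
Proof.
by move=> VF; elim/big_ind: _ => //; [exact: subring_0|exact: subring_D].
Qed.
Lemma subring_X x n : V x -> V (x ^+ n).
Proof.
by move=> Vx; elim: n => [|n IH]; rewrite ?expr0 // exprS; apply: subring_M.
Qed.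
Lemma subring_nat n : V n%:R.
Proof.
by elim: n => [|n IH]; [exact: subring_0|rewrite -natr1; apply: subring_D].
Qed.
Lemma subring_int (c : int) : V c%:~R.
Proof.
by case: c => n; rewrite ?NegzE ?mulrNz; [|apply: subring_N]; apply: subring_nat.
Qed.
Lemma subring_horner (p : {poly K}) x : (forall i, V p`_i) -> V x -> V p.[x].
Proof.
move=> Vp Vx; rewrite horner_coef; apply: subring_sum => i.
by apply: subring_M => //; apply: subring_X.
Qed.

(** The quotient [V / x V] has [n] elements. *)
Definition has_index x n := exists r : 'I_n -> K,
  (forall i, V (r i)) /\ (forall y, V y -> exists! i, V ((y - r i) / x)).

Lemma has_index_fin (T : finType) x (r : T -> K) : (forall t, V (r t)) ->
  (forall y, V y -> exists! t, V ((y - r t) / x)) -> has_index x #|T|.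
Proof.
move=> Vr ur; exists (r \o enum_val); split=> [i|y /ur[t [rt ut]]]; first exact: Vr.
exists (enum_rank t); split; first by rewrite /= enum_rankK.
by move=> i /ut ->; rewrite enum_valK.
Qed.

Lemma has_index_gt0 x n : has_index x n -> (0 < n)%N.
Proof. by case=> r [_ /(_ 0 subring_0)[i _]]; case: n r i => // r []. Qed.

Lemma congr_trans x a b c :
  V ((a - b) / x) -> V ((b - c) / x) -> V ((a - c) / x).
Proof.
move=> ab bc; rewrite (_ : (a - c) / x = (a - b) / x + (b - c) / x).
  exact: subring_D.
by rewrite -mulrDl addrA subrK.
Qed.

Lemma congr_sym x a b : V ((a - b) / x) -> V ((b - a) / x).
Proof. by move=> ab; rewrite -opprB mulNr; apply: subring_N. Qed.

Lemma congr_dvd x y a b : y != 0 -> V (y / x) ->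
  V ((a - b) / y) -> V ((a - b) / x).
Proof.
move=> y0 xy ab; rewrite (_ : (a - b) / x = (a - b) / y * (y / x)).
  exact: subring_M.
by rewrite mulrA mulfVK.
Qed.

(** A maximal family of pairwise incongruent elements is a system of
    representatives. *)
Lemma has_index_classes (T : finType) x (cl : K -> T) :
  (forall a b, V a -> V b -> cl a = cl b -> V ((a - b) / x)) ->
  exists n, has_index x n.
Proof.
move=> clV.
pose P n := exists r : 'I_n -> K,
  (forall i, V (r i)) /\ (forall i j, V ((r i - r j) / x) -> i = j).
have exP : exists n, `[< P n >].
  by exists 0%N; apply/asboolP; exists (fun=> 0); split=> [[]//|[]//].
have leP n : `[< P n >] -> (n <= #|T|)%N.
  move=> /asboolP[r [Vr rinj]]; rewrite -[n]card_ord.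
  by apply: (@leq_card _ _ (cl \o r)) => i j /= /clV-/(_ (Vr _) (Vr _))/rinj.
case: (ex_maxnP exP leP) => n /asboolP[r [Vr rinj]] maxn.
exists n, r; split=> // y Vy.
have [[i ri]|/forallNP none] := pselect (exists i, V ((y - r i) / x)).
  exists i; split=> // j rj; apply: rinj.
  exact: congr_trans (congr_sym ri) rj.
have : `[< P n.+1 >].
  apply/asboolP; exists (fun i => oapp r y (unlift ord0 i)); split.
    by move=> i; case: unliftP => [j _|_] //=.
  move=> i j; case: unliftP => [i' ->|->]; case: unliftP => [j' ->|->] //=.
  - by move=> /rinj ->.
  - by move=> /congr_sym /none.
  - by move=> /none.
by move=> /maxn; rewrite ltnn.
Qed.

Lemma has_index_le x y n m : y != 0 -> V (y / x) ->
  has_index x n -> has_index y m -> (n <= m)%N.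
Proof.
move=> y0 xy [r [Vr ur]] [s [Vs us]].
have /choice[f fP] : forall i, exists j, V ((r i - s j) / y).
  by move=> i; have [j []] := us _ (Vr i); exists j.
rewrite -[n]card_ord -[m]card_ord; apply: (@leq_card _ _ f) => i j fij.
have rij : V ((r i - r j) / y).
  by apply: congr_trans (fP i) _; rewrite fij; apply: congr_sym.
have [k [_ uk]] := ur _ (Vr i).
have <- : k = i by apply: uk; rewrite subrr mul0r; apply: subring_0.
by apply: uk; apply: congr_dvd y0 xy rij.
Qed.

Lemma has_index_inj x n m : x != 0 -> has_index x n -> has_index x m -> n = m.
Proof.
move=> x0 xn xm; have Vxx : V (x / x) by rewrite divff.
by apply/anti_leq; rewrite (has_index_le x0 Vxx xn xm) (has_index_le x0 Vxx xm xn).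
Qed.

Lemma has_index_mul x y n m : x != 0 -> y != 0 -> V x -> V y ->
  has_index x n -> has_index y m -> has_index (x * y) (n * m).
Proof.
move=> x0 y0 Vx Vy [r [Vr ur]] [s [Vs us]].
have -> : (n * m = #|{: 'I_n * 'I_m}|)%N by rewrite card_prod !card_ord.
have eqV z i j : (z - (r i + x * s j)) / (x * y) = ((z - r i) / x - s j) / y.
  by field; rewrite x0 y0.
apply: (@has_index_fin _ _ (fun t => r t.1 + x * s t.2)) => [t|z Vz].
  by apply: subring_D => //; apply: subring_M.
have [i [ri ui]] := ur _ Vz; have [j [sj uj]] := us _ ri.
exists (i, j); split; first by rewrite eqV.
move=> [i' j']; rewrite eqV /= => sj'.
have ri' : V ((z - r i') / x).
  rewrite -[X in V X](subrK (s j')); apply: subring_D => //.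
  by rewrite -[X in V X](mulfVK y0); apply: subring_M.
by move: sj'; rewrite -(ui _ ri') => /uj ->.
Qed.

Lemma has_index_1 : has_index 1 1.
Proof.
exists (fun=> 0); split=> [_|y Vy]; first exact: subring_0.
by exists ord0; split=> [|i _]; rewrite ?ord1 // subr0 divr1.
Qed.

Lemma unit_of_has_index_1 x : has_index x 1 -> V x^-1.
Proof.
case=> r [_ ur]; have [i [r1 _]] := ur _ V1.
have [j [r0 _]] := ur _ subring_0.
rewrite -[x^-1]mul1r -[1]subr0; apply: congr_trans r1 _.
by rewrite !ord1 in r0 *; apply: congr_sym.
Qed.

Lemma has_index_dvd x y m : y != 0 -> V (y / x) -> has_index y m ->
  exists n, has_index x n.
Proof.
move=> y0 xy [r [Vr ur]].
have /choice[cl clP] : forall a, exists i, V a -> V ((a - r i) / y).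
  move=> a; have [/ur[j [rj _]]|nVa] := pselect (V a); first by exists j.
  by have [i _] := ur _ subring_0; exists i.
apply: (@has_index_classes _ x cl) => a b Va Vb eqcl.
apply: (congr_dvd y0 xy).
by apply: congr_trans (clP _ Va) _; rewrite eqcl; apply/congr_sym/clP.
Qed.

(** Elements independent modulo a prime [p] are linearly independent over the
    rationals, so that [V / p V] is a vector space of dimension at most [K : Q]
    over the field with [p] elements. *)
Lemma natK_neq0 n : (n%:R != 0 :> K) = (0 < n)%N.
Proof.
by rewrite -[_%:R](rmorph_nat (in_alg K)) fmorph_eq0 pnatr_eq0 lt0n.
Qed.

Lemma has_index_prime p : prime p -> exists n, has_index p%:R n.
Proof.
move=> pr_p; have p0 : p%:R != 0 :> K by rewrite natK_neq0 prime_gt0.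
pose P m := exists e : 'I_m -> K, (forall i, V (e i)) /\
  forall c : 'I_m -> int, V ((\sum_i (c i)%:~R * e i) / p%:R) ->
    forall i, (p%:Z %| c i)%Z.
have exP : exists m, `[< P m >].
  by exists 0%N; apply/asboolP; exists (fun=> 0); split=> [[]//|c _ []//].
have leP m : `[< P m >] -> (m <= \dim {:K})%N.
  move=> /asboolP[e [Ve indep]]; rewrite leqNgt; apply/negP => ltm.
  have [c rel [i ndvd]] := exists_primitive_int_relation e pr_p ltm.
  by move: ndvd; rewrite indep // rel mul0r; apply: subring_0.
case: (ex_maxnP exP leP) => m /asboolP[e [Ve indep]] maxm.
have Vsum (c : 'I_m -> int) : V (\sum_i (c i)%:~R * e i).
  by apply: subring_sum => i; apply: subring_M => //; apply: subring_int.
have p_gt0 : (0 < p)%N by apply: prime_gt0.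
have /choice[cl clP] : forall y, exists c : {ffun 'I_m -> 'I_p},
    V y -> V ((y - \sum_i (c i)%:R * e i) / p%:R).
  move=> y; have [Vy|] := pselect (V y); last by exists [ffun=> Ordinal p_gt0].
  (* By maximality of [e], [y] depends on it modulo [p], with a coefficient of
     [y] prime to [p]. *)
  have /forallNP/(_ (fun i => oapp e y (unlift ord0 i)))/not_andP : ~ P m.+1.
    by move/asboolP/maxm; rewrite ltnn.
  case=> [[]|]; first by move=> i; case: unliftP => [j _|_] /=.
  move=> /existsNP[c /not_implyP[+ /existsNP[i0 /negP]]].
  rewrite big_ord_recl unlift_none /=; under eq_bigr do rewrite liftK /=.
  set s := \sum_(i < m) _ => Vc ndvd.
  have Vcp : V ((c ord0)%:~R * y) by apply: subring_M => //; apply: subring_int.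
  have ndvd0 : ~~ (p%:Z %| c ord0)%Z.
    apply: contraNN ndvd => /dvdzP[q c0q].
    case: (unliftP ord0 i0) => [j ->|->]; last by rewrite c0q dvdz_mull.
    apply: (indep (fun i => c (lift ord0 i))); rewrite -/s.
    rewrite -[s](addKr ((c ord0)%:~R * y)) addrC mulrBl.
    apply: subring_B => //; rewrite c0q intrM mulrAC mulfK //.
    by apply: subring_M => //; apply: subring_int.
  have [u [w uw]] := Bezoutz (c ord0) p%:Z.
  have {}uw : u * c ord0 + w * p%:Z = 1.
    rewrite uw; apply/eqP; rewrite -/(coprimez _ _) coprimez_sym coprimezE.
    by rewrite prime_coprime.
  pose c' i := - u * c (lift ord0 i).
  have ltd i : (`|(c' i %% p)%Z| < p)%N.
    by rewrite -ltz_nat gez0_abs ?modz_ge0 ?ltz_pmod ?gtn_eqF //; case: (p) p_gt0.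
  exists [ffun i => Ordinal (ltd i)] => _.
  under eq_bigr => i _ do rewrite ffunE /=.
  have dE i : (`|(c' i %% p)%Z|)%:R = - u%:~R * (c (lift ord0 i))%:~R
      - (c' i %/ p)%Z%:~R * p%:R :> K.
    rewrite -[(`|_|)%:R]/((`|_|%N%:Z)%:~R) gez0_abs ?modz_ge0 //; last first.
      by case: (p) p_gt0.
    by rewrite -[p%:R]/((p%:Z)%:~R) -rmorphN -!intrM -rmorphB.
  have -> : y - \sum_i (`|(c' i %% p)%Z|)%:R * e i =
      u%:~R * ((c ord0)%:~R * y + s) + p%:R * (w%:~R * y
        + \sum_i (c' i %/ p)%Z%:~R * e i).
    under eq_bigr do rewrite dE mulrBl.
    rewrite sumrB.
    have -> : \sum_(i < m) - u%:~R * (c (lift ord0 i))%:~R * e i = - u%:~R * s.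
      by rewrite big_distrr; apply: eq_bigr => i _; rewrite /= mulrA.
    have -> : \sum_(i < m) (c' i %/ p)%Z%:~R * p%:R * e i =
       p%:R * \sum_i (c' i %/ p)%Z%:~R * e i.
      by rewrite big_distrr; apply: eq_bigr => i _; rewrite /= mulrA [p%:R * _]mulrC.
    have e1 : 1 = u%:~R * (c ord0)%:~R + w%:~R * p%:R :> K.
      by rewrite -[p%:R]/((p%:Z)%:~R) -!intrM -intrD uw.
    have ey : y = (u%:~R * (c ord0)%:~R + w%:~R * p%:R) * y by rewrite -e1 mul1r.
    rewrite {1}ey; set t := \sum_i _; ring.
  rewrite mulrDl -mulrA; apply: subring_D.
    by apply: subring_M => //; apply: subring_int.
  rewrite mulrC mulKf //; apply: subring_D.
    by apply: subring_M => //; apply: subring_int.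
  by apply: subring_sum => i; apply: subring_M => //; apply: subring_int.
apply: (has_index_classes (cl := cl)) => a b Va Vb eqcl.
by apply: congr_trans (clP _ Va) _; rewrite eqcl; apply/congr_sym/clP.
Qed.

(** [x] divides a nonzero integer, which is a product of primes. *)
Lemma has_index_exists x : V x -> x != 0 -> exists n, has_index x n.
Proof.
move=> Vx x0; have [c [g [c0 cE]]] := exists_int_multiple x0.
have natx (n : nat) : (0 < n)%N -> exists m, has_index n%:R m.
  elim/ltn_ind: n => n IH n0; have [n1|n1] := leqP n 1.
    by exists 1%N; rewrite (_ : n = 1%N); [exact: has_index_1|apply/anti_leq/andP].
  have pr := pdiv_prime n1; have /dvdnP[q nq] := pdiv_dvd n.
  have q0 : (0 < q)%N by move: n0; rewrite nq muln_gt0 => /andP[].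
  have ltq : (q < n)%N by rewrite [X in (_ < X)%N]nq ltn_Pmulr ?prime_gt1.
  have [mq qE] := IH q ltq q0; have [mp pE] := has_index_prime pr.
  exists (mq * mp)%N; rewrite nq natrM.
  by apply: has_index_mul => //; rewrite ?natK_neq0 ?(prime_gt0 pr) //; apply: subring_nat.
have [m cm] : exists m, has_index (`|c|%N)%:R m by apply: natx; rewrite absz_gt0.
apply: has_index_dvd cm; first by rewrite natK_neq0 absz_gt0.
have Vg : V (c%:~R / x).
  rewrite cE mulrC mulKf //; apply: subring_horner => // i.
  by rewrite coef_map; apply: subring_int.
rewrite -[(`|_|)%:R]/((`|c|%N%:Z)%:~R); have [c_ge0|c_lt0] := leP 0 c.
  by rewrite gez0_abs.
by rewrite ltz0_abs // rmorphN mulNr; apply: subring_N.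
Qed.

Hypothesis valV : forall x, x != 0 -> V x \/ V x^-1.

Definition ring_index x : nat :=
  if pselect (exists n, has_index x n) is left e then projT1 (cid e) else 0%N.

Lemma ring_indexP x : V x -> x != 0 -> has_index x (ring_index x).
Proof.
move=> Vx x0; rewrite /ring_index; case: pselect => [e|]; first by case: cid.
by case; apply: has_index_exists.
Qed.

Lemma ring_index_gt0 x : V x -> x != 0 -> (0 < ring_index x)%N.
Proof. by move=> Vx x0; apply: has_index_gt0 (ring_indexP Vx x0). Qed.

Lemma ring_indexM x y : V x -> x != 0 -> V y -> y != 0 ->
  ring_index (x * y) = (ring_index x * ring_index y)%N.
Proof.
move=> Vx x0 Vy y0; have xy0 : x * y != 0 by rewrite mulf_neq0.
apply: (has_index_inj xy0); first exact: (ring_indexP (subring_M Vx Vy)).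
by apply: has_index_mul => //; apply: ring_indexP.
Qed.

Lemma ring_index1 : ring_index 1 = 1%N.
Proof.
apply: (@has_index_inj 1); rewrite ?oner_eq0 //; last exact: has_index_1.
by apply: ring_indexP; rewrite ?oner_eq0.
Qed.

Lemma ring_index_eq1 x : V x -> x != 0 -> ring_index x = 1%N -> V x^-1.
Proof. by move=> Vx x0 i1; apply: unit_of_has_index_1; rewrite -i1; apply: ring_indexP. Qed.

Lemma ring_frac x : x != 0 -> exists a b, [/\ V a, a != 0, V b, b != 0 & x = a / b].
Proof.
move=> x0; have [Vx|Vx] := valV x0; first by exists x, 1; rewrite divr1 oner_eq0.
by exists 1, x^-1; rewrite oner_eq0 invr_eq0 mul1r invrK.
Qed.

Variable R : realType.

(** The extension to [K] of the function [1 / #(V / x V)]. *)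
Definition ring_val x : R :=
  if x == 0 then 0 else
  if pselect (V x) then (ring_index x)%:R^-1 else (ring_index x^-1)%:R.

Lemma ring_val_frac a b : V a -> a != 0 -> V b -> b != 0 ->
  ring_val (a / b) = (ring_index b)%:R / (ring_index a)%:R.
Proof.
move=> Va a0 Vb b0; have q0 : a / b != 0 by rewrite mulf_neq0 ?invr_eq0.
have ia := ring_index_gt0 Va a0; have ib := ring_index_gt0 Vb b0.
rewrite /ring_val (negPf q0); case: pselect => [Vq|nVq].
  have := ring_indexM Vq q0 Vb b0; rewrite mulfVK // => ->.
  by rewrite natrM /= invfM mulrCA divff ?mulr1 // pnatr_eq0 -lt0n.
have Vq : V (a / b)^-1 by case: (valV q0).
have q'0 : (a / b)^-1 != 0 by rewrite invr_eq0.
have := ring_indexM Vq q'0 Va a0; rewrite invf_div mulfVK // => ->.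
by rewrite natrM mulfK // pnatr_eq0 -lt0n.
Qed.

Lemma ring_valM x y : ring_val (x * y) = ring_val x * ring_val y.
Proof.
have [->|x0] := eqVneq x 0; first by rewrite mul0r /ring_val eqxx mul0r.
have [->|y0] := eqVneq y 0; first by rewrite mulr0 /ring_val eqxx mulr0.
have [a [b [Va a0 Vb b0 ->]]] := ring_frac x0.
have [c [d [Vc c0 Vd d0 ->]]] := ring_frac y0.
rewrite mulf_div !ring_val_frac ?mulf_neq0 //; try exact: subring_M.
by rewrite !ring_indexM // !natrM mulf_div.
Qed.

Lemma ring_val_gt0 x : x != 0 -> 0 < ring_val x.
Proof.
move=> x0; have [a [b [Va a0 Vb b0 ->]]] := ring_frac x0.
by rewrite ring_val_frac // divr_gt0 // ltr0n ring_index_gt0.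
Qed.

Lemma ring_val_le1 x : ring_val x <= 1 <-> V x.
Proof.
rewrite /ring_val; case: eqVneq => [->|x0].
  by split=> _; [exact: subring_0|exact: ler01].
case: pselect => [Vx|nVx].
  by split=> // _; rewrite invf_le1 ?ler1n ?ltr0n ring_index_gt0.
have Vx' : V x^-1 by case: (valV x0).
split=> /= [le1|//]; case: nVx; rewrite -[x]invrK.
apply: ring_index_eq1; rewrite ?invr_eq0 //; apply/anti_leq.
by rewrite ring_index_gt0 ?invr_eq0 // andbT; rewrite -(ler_nat R).
Qed.

Lemma ring_val1 : ring_val 1 = 1.
Proof. by rewrite -[X in ring_val X](divr1 1) ring_val_frac ?oner_eq0 // ring_index1 divff ?oner_eq0. Qed.

Lemma ring_val_ultra x y : ring_val (x + y) <= Num.max (ring_val x) (ring_val y).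
Proof.
have val_ge0 z : 0 <= ring_val z.
  by have [->|/ring_val_gt0/ltW//] := eqVneq z 0; rewrite /ring_val eqxx.
wlog Vxy : x y / y != 0 /\ V (x / y).
  move=> H; have [->|x0] := eqVneq x 0.
    by rewrite add0r le_max lexx orbT.
  have [->|y0] := eqVneq y 0; first by rewrite addr0 le_max lexx.
  have [Vq|Vq] := valV (mulf_neq0 x0 (invr_neq0 y0)); first exact: H.
  by rewrite addrC maxC; apply: H; rewrite -invf_div.
case: Vxy => y0 Vxy; rewrite le_max; apply/orP; right.
rewrite -[x](mulfVK y0) -[X in _ + X]mul1r -mulrDl ring_valM ler_piMl //.
by apply/ring_val_le1; apply: subring_D.
Qed.

Lemma ring_val_index x n : V x -> x != 0 -> has_index x n -> ring_val x = n%:R^-1.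
Proof.
move=> Vx x0 /(has_index_inj x0 (ring_indexP Vx x0)) <-.
by rewrite -[x in LHS]divr1 ring_val_frac ?oner_eq0 // ring_index1 mul1r.
Qed.

(** A nonunit [pi] for which [V / pi V] is as small as possible divides all
    nonunits, hence generates the maximal ideal of [V]. *)
Lemma ring_val_place : (exists w, [/\ V w, w != 0 & ~ V w^-1]) ->
  finite_place ring_val.
Proof.
case=> w [Vw w0 nVw'].
have val0 : ring_val 0 = 0 by rewrite /ring_val eqxx.
have valV' x : x != 0 -> ring_val x^-1 = (ring_val x)^-1.
  move=> x0; have := ring_valM x x^-1; rewrite divff // ring_val1 => e.
  by rewrite -[RHS]mulr1 e mulKf // gt_eqF ?ring_val_gt0.
pose P n := exists x, [/\ V x, x != 0, ~ V x^-1 & ring_index x = n].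
have exP : exists n, `[< P n >].
  by exists (ring_index w); apply/asboolP; exists w.
case: (ex_minnP exP) => q /asboolP[pi [Vpi pi0 nVpi' piq]] minq.
have valpi : ring_val pi = q%:R^-1.
  by rewrite -piq; apply: ring_val_index => //; apply: ring_indexP.
have valpi_lt1 : ring_val pi < 1.
  rewrite ltNge; apply/negP => ge1; apply: nVpi'; apply/ring_val_le1.
  by rewrite valV' // invf_le1 ?ring_val_gt0.
have dvd_pi z : ring_val z < 1 <-> V (z / pi).
  have [->|z0] := eqVneq z 0.
    by rewrite val0 mul0r; split=> _; [exact: subring_0|exact: ltr01].
  split=> [lt1|/ring_val_le1].
    have Vz : V z by apply/ring_val_le1/ltW.
    have zpi0 : z / pi != 0 by rewrite mulf_neq0 ?invr_eq0.
    have [//|Vq] := valV zpi0; rewrite -[_ / _]invrK.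
    have nVz' : ~ V z^-1.
      by move/ring_val_le1; rewrite valV' // invf_le1 ?ring_val_gt0 // leNgt lt1.
    have leq : (q <= ring_index z)%N.
      by apply: minq; apply/asboolP; exists z.
    apply: ring_index_eq1; rewrite ?invr_eq0 //; rewrite invf_div in Vq *.
    have piz0 : pi / z != 0 by rewrite mulf_neq0 ?invr_eq0.
    have := ring_indexM Vq piz0 Vz z0; rewrite mulfVK // piq => qE.
    have i0 := ring_index_gt0 Vz z0; have j0 := ring_index_gt0 Vq piz0.
    by apply/anti_leq; rewrite j0 andbT -(leq_pmul2r i0) -qE mul1n.
  by rewrite ring_valM valV' // ler_pdivrMr ?ring_val_gt0 // mul1r => /le_lt_trans ->.
split=> //.
- exact: ring_val_gt0.
- exact: ring_valM.
- exact: ring_val_ultra.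
have [r [Vr ur]] := ring_indexP Vpi pi0; rewrite piq in r Vr ur.
exists q, r, pi; split=> //.
- by move=> i; apply/ring_val_le1.
- move=> x /ring_val_le1/ur[i [ri ui]]; exists i; split; first exact/dvd_pi.
  by move=> j /dvd_pi/ui.
- move=> x /dvd_pi/ring_val_le1.
  by rewrite ring_valM valV' // ler_pdivrMr ?ring_val_gt0 // mul1r.
Qed.

End ValuationRing.

Lemma exprV_cancel (F : fieldType) (x : F) i n : x != 0 -> (i <= n)%N ->
  x^-1 ^+ i * x ^+ n = x ^+ (n - i).
Proof.
by move=> x0 le; rewrite -{1}(subnK le) exprD mulrCA exprVn mulVf ?mulr1 ?expf_neq0.
Qed.

(** Choose [V] maximal among the subrings containing [1 / y] but not [y].  If
    [x] is not in [V], maximality makes [y] a polynomial in [x] over [V]; if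
    neither [x] nor [1 / x] were in [V], combining two such expressions of least
    degrees would give one of smaller degree. *)
Lemma ex_valuation_ring (K : fieldExtType rat) (y : K) :
  ~ integralOver (intr : int -> K) y ->
  exists V : set K, [/\ subring_set V, forall x, x != 0 -> V x \/ V x^-1,
    V y^-1 & ~ V y].
Proof.
move=> nint; have y0 : y != 0.
  by apply: contra_notN nint => /eqP ->; apply: mxpoly.integral0.
pose P (A : set K) := A = set0 \/ [/\ subring_set A, A y^-1 & ~ A y].
have [V [PV maxV]] : exists V, P V /\ forall B, V `<` B -> ~ P B.
  apply: Zorn_bigcup => F FP tot.
  have [[A0 [FA0 A0ne]]|none] := pselect (exists A, F A /\ A !=set0); last first.
    left; rewrite -subset0 => x [A FA Ax]; case: none; exists A; split=> //.
    by exists x.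
  have good A x : F A -> A x -> [/\ subring_set A, A y^-1 & ~ A y].
    by move=> FA Ax; case: (FP _ FA) => // A_0; rewrite A_0 in Ax.
  have [x0 A0x0] := A0ne; have [[A01 _ _] A0y _] := good _ _ FA0 A0x0.
  right; split; last by move=> [A FA Ay]; have [_ _] := good _ _ FA Ay.
    split; first by exists A0.
      move=> x z [A FA Ax] [B FB Bz].
      have [[_ AB _] _ _] := good _ _ FA Ax; have [[_ BB _] _ _] := good _ _ FB Bz.
      have [le|le] := tot _ _ FA FB; first by exists B => //; apply: BB => //; apply: le.
      by exists A => //; apply: AB => //; apply: le.
    move=> x z [A FA Ax] [B FB Bz].
    have [[_ _ AM] _ _] := good _ _ FA Ax; have [[_ _ BM] _ _] := good _ _ FB Bz.
    have [le|le] := tot _ _ FA FB; first by exists B => //; apply: BM => //; apply: le.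
    by exists A => //; apply: AM => //; apply: le.
  by exists A0.
(* [Z[1/y]] does not contain [y], so the maximal set is not empty. *)
pose A0 : set K := [set z | exists p : {poly int}, z = (map_poly intr p).[y^-1]].
have A0y : ~ A0 y.
  case=> p yp; apply: nint; pose n := size p.
  have n0 : (0 < n)%N.
    rewrite lt0n size_poly_eq0; apply: contraNneq y0 => p0.
    by rewrite yp p0 rmorph0 horner0.
  exists ('X^n - \poly_(j < n) p`_(n.-1 - j)).
    rewrite monicE lead_coefDl ?lead_coefXn // size_opp size_polyXn ltnS.
    exact: size_poly.
  rewrite rmorphB /= map_polyXn rootE hornerD hornerN hornerXn subr_eq0.
  rewrite -{1}(prednK n0) exprS {1}yp horner_coef size_map_poly_id0; last first.
    by rewrite intr_eq0K lead_coef_eq0 -size_poly_gt0.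
  rewrite (reindex_inj rev_ord_inj) big_distrl /=.
  rewrite (@horner_coef_wide _ n); last first.
    by apply: leq_trans (size_poly _ _) _; apply: size_poly.
  apply/eqP/eq_bigr => i _; rewrite !coef_map /= coef_poly ltn_ord.
  have -> : (size p - i.+1 = n.-1 - i)%N by rewrite -subn1 -subnDA.
  rewrite -mulrA exprV_cancel ?leq_subr // subKn //.
  by rewrite -ltnS prednK.
have PA0 : P A0.
  right; split=> //; last by exists 'X; rewrite map_polyX hornerX.
  split; first by exists 1; rewrite rmorph1 hornerC.
    by move=> _ _ [p ->] [q ->]; exists (p - q); rewrite rmorphB hornerD hornerN.
  by move=> _ _ [p ->] [q ->]; exists (p * q); rewrite rmorphM hornerM.
have {PV} [ringV Vy' nVy] : [/\ subring_set V, V y^-1 & ~ V y].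
  case: PV => // V0; case: (maxV _ _ PA0); rewrite V0; split=> [//|sub].
  by apply: (sub 1); exists 1; rewrite rmorph1 hornerC.
have V0 := subring_0 ringV.
have V1 : V 1 by case: ringV.
have adjoin x : ~ V x -> exists n (c : nat -> K),
    (forall i, V (c i)) /\ y = \sum_(i < n.+1) c i * x ^+ i.
  move=> nVx.
  pose B : set K := [set z | exists p : {poly K}, (forall i, V p`_i) /\ z = p.[x]].
  have VB : V `<` B.
    split.
      move=> z Vz; exists z%:P; rewrite hornerC; split=> // i.
      by rewrite coefC; case: ifP.
    move=> /(_ x) BV; apply: nVx; apply: BV; exists 'X; rewrite hornerX.
    by split=> // i; rewrite coefX; case: eqP.
  have [p [Vp yp]] : B y.
    apply: contrapT => nBy; apply: (maxV B VB); right; split=> //; last first.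
      by case: VB => + _; apply.
    split; first by case: VB => + _; apply.
      move=> _ _ [p [Vp ->]] [q [Vq ->]]; exists (p - q).
      by rewrite hornerD hornerN; split=> // i; rewrite coefB; apply: subring_B.
    move=> _ _ [p [Vp ->]] [q [Vq ->]]; exists (p * q).
    rewrite hornerM; split=> // i; rewrite coefM.
    by apply: subring_sum => // j; apply: subring_M.
  exists (size p), (fun i => p`_i); split=> //.
  by rewrite yp (@horner_coef_wide _ (size p).+1).
(* Otherwise [y] would be a polynomial in the inverse of [s = 1 + u / y], and
   then [y * s ^ n], which is [y] plus an element of [V], would lie in [V]. *)
have unit_near1 u : V u -> V (1 + u / y)^-1.
  move=> Vu; have Vs : V (1 + u / y) by apply: subring_D => //; apply: subring_M.
  apply: contrapT => nVs'; have [n [c [Vc yE]]] := adjoin _ nVs'.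
  have s0 : 1 + u / y != 0.
    by apply: contra_notN nVs' => /eqP ->; rewrite invr0.
  have [w Vw sn] : exists2 w, V w & (1 + u / y) ^+ n = 1 + w / y.
    elim: n {c Vc yE} => [|n [w Vw IH]]; first by exists 0; rewrite // mul0r addr0.
    exists (w + u + w * (u / y)).
      by do !apply: subring_D => //; do !apply: subring_M => //.
    by rewrite exprSr IH; field.
  case: nVy; rewrite -[y](addrK w); apply: subring_B => //.
  have -> : y + w = y * (1 + u / y) ^+ n by rewrite sn mulrDr mulr1 mulrCA divff ?mulr1.
  rewrite {1}yE big_distrl /=; apply: subring_sum => // i.
  rewrite -mulrA; apply: subring_M => //.
  by rewrite exprV_cancel ?leq_ord //; apply: subring_X.
pose D x n := exists c : nat -> K,
  (forall i, V (c i)) /\ y = \sum_(i < n.+1) c i * x ^+ i.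
(* Lower the degree in [x] using the relation for [1/x]. *)
have noD N x n m : (n + m <= N)%N -> x != 0 -> D x n -> D x^-1 m -> False.
  elim: N x n m => [|N IH] x n m leN x0 Dx Dx'.
    case: Dx => c [Vc yE]; apply: nVy; rewrite yE.
    have -> : n = 0%N by case: n leN {yE}.
    by rewrite big_ord1 expr0 mulr1.
  wlog lemn : x n m leN x0 Dx Dx' / (m <= n)%N.
    move=> H; have [le|/ltnW le] := leqP m n; first exact: (H x n m).
    by apply: (H x^-1 m n); rewrite ?invr_eq0 ?invrK // addnC.
  case: Dx' => q [Vq yq]; case: Dx => p [Vp yp].
  case: m => [|m] in leN lemn yq *.
    by apply: nVy; rewrite yq big_ord1 expr0 mulr1.
  case: n => [//|n] in leN lemn yp *.
  have := unit_near1 (- q 0%N) (subring_N ringV (Vq _)).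
  set s := 1 + _ => Vs'.
  have s0 : s != 0.
    apply: contra_notN nVy => /eqP e; have : y * s = 0 by rewrite e mulr0.
    rewrite /s mulrDr mulr1 mulrCA divff // mulr1 => /eqP.
    by rewrite subr_eq0 => /eqP ->.
  have yx : y * x ^+ n.+1 = \sum_(j < m.+1) q j.+1 / s * x ^+ (n - j).
    apply: (mulfI s0).
    have -> : s * (y * x ^+ n.+1) = (y - q 0%N) * x ^+ n.+1 by rewrite /s; field.
    rewrite {1}yq big_ord_recl expr0 mulr1 addrC addKr mulr_suml mulr_sumr.
    apply: eq_bigr => j _; rewrite lift0 -mulrA exprV_cancel //; last first.
      exact: leq_trans (ltn_ord j) lemn.
    by rewrite subSS mulrA [s * _]mulrC divfK.
  pose d j := if (j < m.+1)%N then q j.+1 / s else 0.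
  have Vd j : V (d j) by rewrite /d; case: ifP => // _; apply: subring_M.
  apply: (IH x n m.+1) => //; last by exists q.
  exists (fun i => p i + p n.+1 / y * d (n - i)%N); split=> [i|].
    by apply: subring_D => //; do 2!apply: subring_M => //.
  rewrite {1}yp big_ord_recr /=; under [in RHS]eq_bigr do rewrite mulrDl.
  rewrite big_split /=; congr (_ + _).
  transitivity (p n.+1 / y * (y * x ^+ n.+1)); first by field.
  rewrite yx [in RHS](reindex_inj rev_ord_inj) big_distrr /=.
  rewrite (big_ord_widen n.+1 (fun j => p n.+1 / y * (q j.+1 / s * x ^+ (n - j)))) //.
  rewrite big_mkcond /=; apply: eq_bigr => j _.
  rewrite subSS subKn ?leq_ord // /d; case: ifP => _; last by rewrite mulr0 mul0r.
  by rewrite !mulrA.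
exists V; split=> // x x0; apply: contrapT => /not_orP[nVx nVx'].
have [n Dn] := adjoin _ nVx; have [m Dm] := adjoin _ nVx'.
exact: (noD (n + m)%N x n m).
Qed.

(** A non-integral [y] has value greater than 1 at the place of a valuation ring
    that contains [1 / y] but not [y]. *)
Lemma integral_of_places (R : realType) (K : fieldExtType rat) (y : K) :
  (forall v : K -> R, finite_place v -> v y <= 1) ->
  integralOver (intr : int -> K) y.
Proof.
move=> le1; apply: contrapT => /ex_valuation_ring[V [ringV valV Vy' nVy]].
apply: (nVy); rewrite -(ring_val_le1 ringV valV R); apply: le1.
apply: ring_val_place => //; exists y^-1; rewrite invrK invr_eq0; split=> //.
by apply: contra_notN nVy => /eqP ->; apply: subring_0.
Qed.

(** * Finite places *)

Section Places.
Variables (R : realType) (K : fieldExtType rat).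
Implicit Types (v w : K -> R) (x y : K).

Section OnePlace.
Variable v : K -> R.
Hypothesis pv : finite_place v.

Lemma place0 : v 0 = 0. Proof. by case: pv. Qed.
Lemma place_gt0 x : x != 0 -> 0 < v x. Proof. by case: pv => _ + _ _ _; apply. Qed.
Lemma placeM x y : v (x * y) = v x * v y. Proof. by case: pv. Qed.
Lemma place_ge0 x : 0 <= v x.
Proof. by have [->|/place_gt0/ltW//] := eqVneq x 0; rewrite place0. Qed.
Lemma place1 : v 1 = 1.
Proof.
by apply: (mulfI (lt0r_neq0 (place_gt0 (oner_neq0 _)))); rewrite -placeM !mulr1.
Qed.
Lemma placeX x n : v (x ^+ n) = v x ^+ n.
Proof. by elim: n => [|n IH]; rewrite ?expr0 ?place1 // !exprS placeM IH. Qed.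
Lemma placeV x : v x^-1 = (v x)^-1.
Proof.
have [->|x0] := eqVneq x 0; first by rewrite invr0 place0 invr0.
apply: (mulfI (lt0r_neq0 (place_gt0 x0))).
by rewrite -placeM !divff ?place1 ?lt0r_neq0 ?place_gt0.
Qed.
Lemma placeN x : v (- x) = v x.
Proof.
have vN1 : v (-1) = 1.
  apply/eqP; rewrite -(@pexpr_eq1 _ _ 2) ?place_ge0 //.
  by rewrite -placeX sqrrN expr1n place1.
by rewrite -mulN1r placeM vN1 mul1r.
Qed.
Lemma placeD x y (b : R) : v x <= b -> v y <= b -> v (x + y) <= b.
Proof.
move=> xb yb; case: pv => _ _ _ /(_ x y)/le_trans + _; apply.
by rewrite ge_max xb yb.
Qed.
Lemma placeD_lt x y (b : R) : v x < b -> v y < b -> v (x + y) < b.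
Proof.
move=> xb yb; case: pv => _ _ _ /(_ x y)/le_lt_trans + _; apply.
by rewrite gt_max xb yb.
Qed.
Lemma place_sum (I : Type) (s : seq I) (P : pred I) (F : I -> K) (b : R) :
  0 <= b -> (forall i, P i -> v (F i) <= b) -> v (\sum_(i <- s | P i) F i) <= b.
Proof.
move=> b0 Fb; elim/big_rec: _ => [|i x Pi xb]; first by rewrite place0.
by apply: placeD => //; apply: Fb.
Qed.
Lemma place_sum_lt (I : Type) (s : seq I) (P : pred I) (F : I -> K) (b : R) :
  0 < b -> (forall i, P i -> v (F i) < b) -> v (\sum_(i <- s | P i) F i) < b.
Proof.
move=> b0 Fb; elim/big_rec: _ => [|i x Pi xb]; first by rewrite place0.
by apply: placeD_lt => //; apply: Fb.
Qed.
Lemma placeD_dominant x y : v y < v x -> v (x + y) = v x.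
Proof.
move=> yx; apply/le_anti/andP; split; first by apply: placeD => //; apply: ltW.
rewrite leNgt; apply/negP => xyx.
have := placeD_lt xyx (_ : v (- y) < v x); rewrite addrK placeN ltxx.
by move=> /(_ yx).
Qed.
Lemma placeM_lt x y : v x <= 1 -> v y < 1 -> v (x * y) < 1.
Proof.
by move=> x1; apply: le_lt_trans; rewrite placeM ler_piMl ?place_ge0.
Qed.
Lemma place_nat n : v n%:R <= 1.
Proof.
by elim: n => [|n IH]; rewrite ?place0 ?ler01 // -natr1; apply: placeD; rewrite ?place1.
Qed.
Lemma place_int (c : int) : v c%:~R <= 1.
Proof. by case: c => n; rewrite ?NegzE ?mulrNz ?placeN; apply: place_nat. Qed.

Lemma place_int_dvd (p : nat) (c : int) :
  prime p -> v p%:R < 1 -> ~~ (p%:Z %| c)%Z -> v c%:~R = 1.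
Proof.
move=> pr_p vp ndvd; apply/le_anti; rewrite place_int /= leNgt; apply/negP => vc.
have [u [w uw]] := Bezoutz c p%:Z.
have /(congr1 (fun n => v n%:~R)) : u * c + w * p%:Z = 1.
  rewrite uw; apply/eqP; rewrite -/(coprimez _ _) coprimez_sym coprimezE.
  by rewrite prime_coprime.
rewrite rmorphD !rmorphM /= place1 => v1.
suff : v (u%:~R * c%:~R + w%:~R * p%:R) < 1 by rewrite v1 ltxx.
by apply: placeD_lt; apply: placeM_lt => //; apply: place_int.
Qed.

(** Otherwise the leading term would dominate the others in [q(x) = 0]. *)
Lemma place_lead_coef (q : {poly int}) x : q != 0 -> root (map_poly intr q) x ->
  1 < v x -> v (lead_coef q)%:~R < 1.
Proof.
move=> q0 rx vx; have x0 : x != 0.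
  by apply: contraTneq vx => ->; rewrite place0 ltr10.
have sq0 : (0 < size q)%N by rewrite size_poly_gt0.
set n := (size q).-1; have sqE : size q = n.+1 by rewrite prednK.
have : (map_poly intr q).[x] = \sum_(i < n.+1) (q`_i)%:~R * x ^+ i.
  rewrite (@horner_coef_wide _ n.+1) -?sqE; last exact: size_poly.
  by apply: eq_bigr => i _; rewrite coef_map.
rewrite (eqP rx) big_ord_recr /= => /esym/eqP; rewrite addrC addr_eq0 => /eqP e.
have : v (lead_coef q)%:~R * v x ^+ n <= v x ^+ n.-1.
  rewrite -placeX -placeM e placeN; apply: place_sum => [|i _].
    by rewrite exprn_ge0 ?place_ge0.
  rewrite placeM placeX -[X in _ <= X]mul1r.
  apply: ler_pM; rewrite ?place_ge0 ?exprn_ge0 ?place_ge0 ?place_int //.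
  apply: ler_weXn2l; first exact: ltW.
  by have := ltn_ord i; lia.
have n0 : (0 < n)%N.
  move: rx; rewrite lt0n; apply: contraTneq => n0.
  have /size_poly1P[c c0 ->] : size q == 1%N by rewrite sqE n0.
  by rewrite map_polyC rootC intr_eq0K.
rewrite -{1}(prednK n0) exprS mulrA -[X in _ <= X]mul1r ler_pM2r ?exprn_gt0 ?place_gt0 //.
rewrite -ler_pdivlMr ?place_gt0 // mul1r => /le_lt_trans -> //.
by rewrite invf_lt1 ?place_gt0.
Qed.

(** The order [q] of the residue field is zero in this field: translation by 1
    permutes the residues, and so preserves their sum. *)
Lemma place_uniformizer : exists (q : nat) (pi : K),
  [/\ (1 < q)%N, v pi = q%:R^-1, forall x, v x < 1 -> v x <= q%:R^-1,
      v q%:R <= q%:R^-1 & exists r : 'I_q -> K, (forall i, v (r i) <= 1) /\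
      forall x, v x <= 1 -> exists! i, v (x - r i) < 1].
Proof.
case: pv => _ _ _ _ [q [r [pi [r1 ur vpi max_pi]]]]; exists q, pi.
have max_q x : v x < 1 -> v x <= q%:R^-1 by rewrite -vpi; apply: max_pi.
have vB a b : v a < 1 -> v b < 1 -> v (a - b) < 1.
  by move=> va vb; apply: placeD_lt; rewrite ?placeN.
have q1 : (1 < q)%N.
  rewrite ltnNge; apply/negP => leq1.
  have [i [ri _]] : exists! i, v (1 - r i) < 1 by apply: ur; rewrite place1.
  have [j [rj _]] : exists! i, v (0 - r i) < 1 by apply: ur; rewrite place0 ler01.
  have eij : i = j.
    by apply: val_inj => /=; have := ltn_ord i; have := ltn_ord j; lia.
  have := vB _ _ ri rj; rewrite eij (_ : _ - _ - (_ - _) = 1); last by ring.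
  by rewrite place1 ltxx.
split=> //; last by exists r.
apply: max_q; have /choice[s sP] : forall i, exists j, v (r i + 1 - r j) < 1.
  move=> i; have [j [rj _]] : exists! j, v (r i + 1 - r j) < 1.
    by apply: ur; apply: placeD; rewrite ?place1.
  by exists j.
have s_inj : injective s.
  move=> i j sij; have [k [_ uk]] := ur _ (r1 i).
  have <- : k = i by apply: uk; rewrite subrr place0 ltr01.
  apply: uk; have := vB _ _ (sP i) (sP j).
  by rewrite sij (_ : _ - _ - (_ - _) = r i - r j) //; ring.
have -> : q%:R = \sum_(i < q) (r i + 1 - r (s i)).
  rewrite sumrB big_split /= [X in _ - X](_ : _ = \sum_(i < q) r i).
    by rewrite sumr_const card_ord addrAC subrr add0r.
  by rewrite [RHS](reindex_inj s_inj).
exact: place_sum_lt.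
Qed.

(** Divide [x] by the largest power of a uniformizer inverse not exceeding it: a
    quotient of value other than 1 would have an inverse of value strictly
    between [1 / q] and 1. *)
Lemma place_value (q : nat) pi x : (1 < q)%N -> v pi = q%:R^-1 ->
  (forall y, v y < 1 -> v y <= q%:R^-1) -> 1 < v x ->
  exists2 e, (0 < e)%N & v x = q%:R ^+ e.
Proof.
move=> q1 vpi maxq vx.
have q0 : 0 < q%:R :> R by rewrite ltr0n ltnW.
have x0 : x != 0 by apply: contraTneq vx => ->; rewrite place0 ltr10.
have exP : exists e, v x < q%:R ^+ e.
  exists (Num.bound (v x)); apply: lt_trans (archi_boundP (place_ge0 _)) _.
  by rewrite -natrX ltr_nat ltn_expl.
case: (ex_minnP exP) => -[|e] lte mine.
  by move: lte; rewrite expr0 ltNge (ltW vx).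
have ve : v x = q%:R ^+ e.
  apply/le_anti/andP; split; last first.
    by rewrite leNgt; apply/negP => /mine; rewrite ltnn.
  rewrite leNgt; apply/negP => ltx.
  pose y := (x * pi ^+ e)^-1.
  have vy : v y = q%:R ^+ e / v x.
    by rewrite placeV placeM placeX vpi invfM exprVn invrK mulrC.
  have : v y <= q%:R^-1.
    by apply: maxq; rewrite vy ltr_pdivrMr ?place_gt0 // mul1r.
  rewrite vy ler_pdivrMr ?place_gt0 // leNgt => /negP; apply.
  by rewrite mulrC ltr_pdivrMr // -exprSr.
by exists e => //; case: e ve {lte mine} => // ve; rewrite ve expr0 ltxx in vx.
Qed.

Lemma place_denominator x : 1 < v x -> exists n : nat,
  [/\ (0 < n)%N, v x = n%:R & v n%:R <= (v x)^-1].
Proof.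
have [q [pi [q1 vpi maxq vq _]]] := place_uniformizer.
move=> /(place_value q1 vpi maxq)[e _ ve].
exists (q ^ e)%N; split; [by rewrite expn_gt0 ltnW | by rewrite natrX |].
by rewrite natrX placeX ve -exprVn; apply: lerXn2r => //; rewrite nnegrE ?place_ge0.
Qed.

Lemma place_prime : exists2 p : nat, prime p & v p%:R < 1.
Proof.
have [q [pi [q1 _ _ vq _]]] := place_uniformizer.
have {vq}vq : v q%:R < 1.
  by apply: le_lt_trans vq _; rewrite invf_lt1 ?ltr1n // ltr0n ltnW.
apply: contrapT => noprime.
have vp p : prime p -> v p%:R = 1.
  move=> pr_p; apply/le_anti; rewrite place_nat /= leNgt; apply/negP => lt1.
  by apply: noprime; exists p.
suff vn n : (0 < n)%N -> v n%:R = 1 by rewrite vn ?ltxx // ltnW in vq.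
elim/ltn_ind: n => n IH n0; have [n1|n1] := leqP n 1.
  by rewrite (_ : n = 1%N) ?place1 //; apply/anti_leq/andP.
have pr := pdiv_prime n1; have /dvdnP[m nm] := pdiv_dvd n.
have m0 : (0 < m)%N by move: n0; rewrite nm muln_gt0 => /andP[].
rewrite nm natrM placeM (vp _ pr) mulr1 IH //.
by rewrite [X in (_ < X)%N]nm ltn_Pmulr ?prime_gt1.
Qed.

End OnePlace.

(** The values of a place [v] are the powers of that of a uniformizer, so
    [v x <= 1 -> w x <= 1] makes the exponents of [w] proportional to those of
    [v]; the normalizations then make them equal. *)
Lemma place_le1_inj v w : finite_place v -> finite_place w ->
  (forall x, v x <= 1 -> w x <= 1) -> v = w.
Proof.
move=> pv pw le1.
have [q [pi [q1 vpi maxq _ [r [r1 ur]]]]] := place_uniformizer pv.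
have [q' [pi' [q'1 wpi' maxq' _ [r' [r'1 ur']]]]] := place_uniformizer pw.
have inv_lt1 (u : K -> R) (pu : finite_place u) x : x != 0 -> (u x^-1 < 1) = (1 < u x).
  by move=> x0; rewrite (placeV pu) invf_lt1 // (place_gt0 pu).
have inv_gt1 (u : K -> R) (pu : finite_place u) x : x != 0 -> (1 < u x^-1) = (u x < 1).
  by move=> x0; rewrite (placeV pu) invf_gt1 // (place_gt0 pu).
have pi_lt1 (u : K -> R) z n : (1 < n)%N -> u z = n%:R^-1 -> u z < 1.
  by move=> n1 ->; rewrite invf_lt1 ?ltr1n // ltr0n ltnW.
have nz (u : K -> R) (pu : finite_place u) z n : (1 < n)%N -> u z = n%:R^-1 -> z != 0.
  move=> n1 uz; apply: contra_eq_neq uz => ->; rewrite (place0 pu) eq_sym invr_eq0.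
  by rewrite pnatr_eq0 -lt0n ltnW.
have pi0 := nz _ pv _ _ q1 vpi; have pi'0 := nz _ pw _ _ q'1 wpi'.
have vw1 x : v x = 1 -> w x = 1.
  move=> vx; have x0 : x != 0.
    by apply: contra_eq_neq vx => ->; rewrite (place0 pv) eq_sym oner_eq0.
  apply/le_anti; rewrite le1 ?vx //= -invf_le1 ?(place_gt0 pw) // -(placeV pw).
  by apply: le1; rewrite (placeV pv) vx invr1.
have vwX x : 1 < v x -> exists e, [/\ (0 < e)%N, v x = q%:R ^+ e & w x = (w pi)^-1 ^+ e].
  move=> /(place_value pv q1 vpi maxq)[e e0 vx]; exists e; split=> //.
  have /vw1 : v (x * pi ^+ e) = 1.
    rewrite (placeM pv) (placeX pv) vpi vx -exprMn divff ?expr1n //.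
    by rewrite pnatr_eq0 -lt0n ltnW.
  rewrite (placeM pw) (placeX pw) => e1; rewrite exprVn -[LHS]mulr1.
  by rewrite -(divff (expf_neq0 e (lt0r_neq0 (place_gt0 pw pi0)))) mulrA e1 mul1r.
have wpi_lt1 : w pi < 1.
  rewrite ltNge; apply/negP => ge1.
  have {}ge1 : w pi = 1 by apply/le_anti; rewrite ge1 andbT le1 // ltW ?(pi_lt1 v _ q).
  have w1 x : x != 0 -> w x = 1.
    move=> x0; case: (ltgtP (v x) 1) => [|/vwX[e [_ _ ->]]|/vw1//].
      rewrite -inv_gt1 // => /vwX[e [_ _]]; rewrite (placeV pw) ge1 invr1 expr1n.
      by move=> /(congr1 GRing.inv); rewrite invrK invr1.
    by rewrite ge1 invr1 expr1n.
  by have := pi_lt1 w _ _ q'1 wpi'; rewrite w1 ?ltxx.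
have wle x : v x < 1 -> w x <= w pi.
  move=> vx; have [->|x0] := eqVneq x 0; first by rewrite (place0 pw) (place_ge0 pw).
  move: vx; rewrite -inv_gt1 // => /vwX[e [e0 _]]; rewrite (placeV pw) exprVn.
  move=> /(congr1 GRing.inv); rewrite !invrK => ->; case: e e0 => // e _.
  by rewrite exprS ler_piMr ?(place_ge0 pw) // exprn_ile1 ?(place_ge0 pw) // ltW.
have wlt x : v x < 1 -> w x < 1 by move=> /wle/le_lt_trans; apply.
have vgt x : 1 < v x -> 1 < w x.
  move=> vx; have x0 : x != 0 by apply: contraTneq vx => ->; rewrite (place0 pv) ltr10.
  by rewrite -inv_lt1 //; apply: wlt; rewrite inv_lt1.
have vlt x : w x < 1 -> v x < 1.
  move=> wx; case: (ltgtP (v x) 1) => [//|/vgt|/vw1 e].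
    by rewrite ltNge (ltW wx).
  by rewrite e ltxx in wx.
have wpi : w pi = q'%:R^-1.
  apply/le_anti; rewrite maxq' //= -wpi'; apply: wle; apply: vlt.
  exact: pi_lt1 wpi'.
have eqq : q = q'.
  have res_le (u1 u2 : K -> R) n m (s1 : 'I_n -> K) (s2 : 'I_m -> K) :
      finite_place u1 -> finite_place u2 ->
      (forall x, u1 x <= 1 -> u2 x <= 1) -> (forall x, u2 x < 1 -> u1 x < 1) ->
      (forall i, u1 (s1 i) <= 1) ->
      (forall x, u1 x <= 1 -> exists! i, u1 (x - s1 i) < 1) ->
      (forall x, u2 x <= 1 -> exists! i, u2 (x - s2 i) < 1) -> (n <= m)%N.
    move=> pu1 pu2 u12 u21 s11 us1 us2.
    have /choice[f fP] : forall i, exists j, u2 (s1 i - s2 j) < 1.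
      by move=> i; have [j [fj _]] := us2 _ (u12 _ (s11 i)); exists j.
    rewrite -[n]card_ord -[m]card_ord; apply: (@leq_card _ _ f) => i j fij.
    have [k [_ uk]] := us1 _ (s11 i).
    have <- : k = i by apply: uk; rewrite subrr (place0 pu1) ltr01.
    apply: uk; apply: u21.
    rewrite (_ : _ - _ = s1 i - s2 (f i) - (s1 j - s2 (f j))); last first.
      by rewrite fij; ring.
    by apply: (placeD_lt pu2) => //; rewrite (placeN pu2).
  apply/anti_leq/andP; split; first exact: (res_le v w _ _ r r').
  apply: (res_le w v _ _ r' r) => // x wx; rewrite leNgt; apply/negP => /vgt.
  by rewrite ltNge wx.
apply/funext => x; case: (ltgtP (v x) 1) => [|/vwX[e [_ -> ->]]|vx].
- have [->|x0] := eqVneq x 0; first by rewrite (place0 pv) (place0 pw).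
  rewrite -inv_gt1 // => /vwX[e [_]]; rewrite (placeV pv) (placeV pw) wpi invrK eqq => <-.
  by move=> /(congr1 GRing.inv); rewrite !invrK.
- by rewrite wpi invrK eqq.
- by rewrite vx vw1.
Qed.

End Places.

Section PlaceFamilies.
Variables (R : realType) (K : fieldExtType rat).
Implicit Types (v w : K -> R) (x y : K).

Lemma place_separate2 v w : finite_place v -> finite_place w -> v != w ->
  exists2 x, 1 < v x & w x < 1.
Proof.
move=> pv pw vw.
have ex (u u' : K -> R) : finite_place u -> finite_place u' -> u != u' ->
    exists2 a, u a <= 1 & 1 < u' a.
  move=> pu pu' uu'; apply: contrapT => none.
  case/eqP: uu'; apply: place_le1_inj => // x ux; rewrite leNgt; apply/negP => gt1.
  by apply: none; exists x.
have [a va wa] := ex v w pv pw vw.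
have [b wb vb] : exists2 b, w b <= 1 & 1 < v b by apply: ex => //; rewrite eq_sym.
have a0 : a != 0 by apply: contraTneq wa => ->; rewrite (place0 pw) ltr10.
exists (b / a).
  rewrite (placeM pv) (placeV pv) ltr_pdivlMr ?(place_gt0 pv) // mul1r.
  exact: le_lt_trans vb.
rewrite (placeM pw) (placeV pw) ltr_pdivrMr ?(place_gt0 pw) // mul1r.
exact: le_lt_trans wa.
Qed.

Lemma place_pow_small w x y : finite_place w -> w x < 1 ->
  exists N, forall n, (N <= n)%N -> w x ^+ n * w y < 1.
Proof.
move=> pw wx; have [q [pi [q1 vpi maxq _ _]]] := place_uniformizer pw.
have w2 : w x <= 2^-1.
  by apply: le_trans (maxq _ wx) _; rewrite lef_pV2 ?posrE ?ltr0n ?ler_nat // ltnW.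
exists (Num.bound (w y)) => n len.
have : w x ^+ n * w y <= 2^-1 ^+ n * w y.
  by rewrite ler_wpM2r ?place_ge0 // lerXn2r // nnegrE ?place_ge0.
move=> /le_lt_trans; apply; rewrite exprVn mulrC ltr_pdivrMr ?exprn_gt0 // mul1r.
apply: lt_trans (archi_boundP (place_ge0 pw _)) _.
by rewrite -natrX ltr_nat; apply: leq_ltn_trans len _; rewrite ltn_expl.
Qed.

(** Given such an [x] for [s], and [z] separating [v] from one more place [w],
    take [x ^ N * z] if [w x <= 1] and [x ^ N / (1 + x ^ N) * z] otherwise, with
    [N] large. *)
Lemma place_separate v (s : seq (K -> R)) : finite_place v -> v \notin s ->
  (forall w, w \in s -> finite_place w) ->
  exists2 x, 1 < v x & forall w, w \in s -> w x < 1.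
Proof.
move=> pv; elim: s => [|w s IH].
  move=> _ _; have [q [pi [q1 vpi _ _ _]]] := place_uniformizer pv.
  exists pi^-1 => //; rewrite (placeV pv) vpi invrK ltr1n //.
rewrite inE negb_or => /andP[vw vs] ps.
have pw : finite_place w by apply: ps; rewrite mem_head.
have ps' u : u \in s -> finite_place u by move=> us; apply: ps; rewrite inE us orbT.
have [x vx sx] := IH vs ps'.
have [z vz wz] := place_separate2 pv pw vw.
have [N NP] : exists N, forall n, (N <= n)%N ->
    forall u, u \in s -> u x ^+ n * u z < 1.
  elim: (s) ps' sx => [|u t IHt] pt tx; first by exists 0%N.
  have [||N1 P1] := IHt.
  - by move=> u' u't; apply: pt; rewrite inE u't orbT.
  - by move=> u' u't; apply: tx; rewrite inE u't orbT.
  have [N2 P2] := place_pow_small z (pt u (mem_head _ _)) (tx u (mem_head _ _)).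
  exists (maxn N1 N2) => n; rewrite geq_max => /andP[le1 le2] u'.
  by rewrite inE => /predU1P[->|]; [apply: P2|apply: P1].
set X := x ^+ N.+1; have vX : 1 < v X.
  by rewrite (placeX pv) exprn_egt1.
have sX u : u \in s -> u X < 1.
  by move=> us; rewrite (placeX (ps' _ us)) exprn_ilt1 ?(place_ge0 (ps' _ us)) ?sx.
have sXz u : u \in s -> u X * u z < 1.
  by move=> us; rewrite (placeX (ps' _ us)) NP.
have [wx|wx] := leP (w x) 1.
  exists (X * z); first by rewrite (placeM pv) mulr_egt1.
  move=> u; rewrite inE => /predU1P[->|us]; last by rewrite (placeM (ps' _ us)) sXz.
  by apply: (placeM_lt pw) => //; rewrite (placeX pw) exprn_ile1 ?(place_ge0 pw).
have big_val (u : K -> R) : finite_place u -> 1 < u X -> u (X / (X + 1) * z) = u z.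
  move=> pu uX; rewrite !(placeM pu) (placeV pu) (placeD_dominant pu) ?(place1 pu) //.
  by rewrite divff ?mul1r // gt_eqF // (lt_trans ltr01).
have wX : 1 < w X by rewrite (placeX pw) exprn_egt1.
exists (X / (X + 1) * z); first by rewrite big_val.
move=> u; rewrite inE => /predU1P[->|us]; first by rewrite big_val.
have pu := ps' _ us.
rewrite !(placeM pu) (placeV pu) [X + 1]addrC (placeD_dominant pu) ?(place1 pu) ?sX //.
by rewrite invr1 mulr1 sXz.
Qed.

(** Elements [e i] of value greater than 1 at the place [V i] and less than 1 at
    the other places are linearly independent over the rationals: in a relation
    with integer coefficients, one of them prime to [p], that term has at its
    place a value greater than those of all others. *)
Lemma finite_places_over (p : nat) : prime p ->
  finite_set [set v : K -> R | finite_place v /\ v p%:R < 1].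
Proof.
move=> pr_p; apply: contrapT => /(infinite_set_fset (\dim {:K}).+1)[B sub leB].
set s := finmap.enum_fset B in leB.
have uniqs : uniq s by apply: finmap.fset_uniq.
have sP v : v \in s -> finite_place v /\ v p%:R < 1 by move=> vs; apply: sub.
pose V (i : 'I_(size s)) := nth (fun=> 0) s i.
have Vs i : V i \in s by apply: mem_nth.
have /choice[e eP] : forall i, exists x, 1 < V i x /\ forall j, j != i -> V j x < 1.
  move=> i; have [|||x Vx sx] := @place_separate (V i) (rem (V i) s).
  - by have [] := sP _ (Vs i).
  - by rewrite mem_rem_uniq // inE eqxx.
  - by move=> w /mem_rem/sP[].
  exists x; split=> // j ji; apply: sx; rewrite mem_rem_uniq // inE Vs andbT.
  by apply: contraNneq ji => /eqP; rewrite nth_uniq // => /eqP/val_inj ->.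
have [c rel [i ndvd]] := exists_primitive_int_relation e pr_p leB.
have [pv vp] := sP _ (Vs i); have [ei ej] := eP i.
move: rel; rewrite (bigD1 i) //= => /eqP; rewrite addr_eq0 => /eqP rel.
have : V i ((c i)%:~R * e i) < 1.
  rewrite rel (placeN pv); apply: place_sum_lt => // j ji.
  apply: (placeM_lt pv); first exact: place_int.
  by have [_] := eP j; apply; rewrite eq_sym.
by rewrite (placeM pv) (place_int_dvd pv pr_p vp ndvd) mul1r ltNge (ltW ei).
Qed.

(** A place at which [x] has value greater than 1 lies over a prime divisor of
    the leading coefficient of an integral equation of [x]. *)
Lemma finite_poles x : finite_set [set v : K -> R | finite_place v /\ 1 < v x].
Proof.
have [q q0 rx] := exists_int_poly x; set c := lead_coef q.
apply: (@sub_finite_set _ _ (\bigcup_(p in [set` primes `|c|])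
    [set v : K -> R | finite_place v /\ v p%:R < 1])).
  move=> v [pv vx]; have [p pr_p vp] := place_prime pv.
  exists p => //=; rewrite mem_primes pr_p absz_gt0 lead_coef_eq0 q0 /=.
  have := place_lead_coef pv q0 rx vx; apply: contraTT => ndvd.
  by rewrite -leNgt (place_int_dvd pv pr_p vp) // dvdzE.
apply: bigcup_finite => [|p]; first exact: finite_seq.
by rewrite /= mem_primes => /andP[pr_p _]; apply: finite_places_over.
Qed.

(** The product of the local factors of the height at the finite places is a
    common denominator of [x], because the value [q ^ e > 1] of [x] at a place
    is itself an integer of value at most [q ^- e] there. *)
Lemma height_denominator x : exists a : nat, [/\ (0 < a)%N,
  \big[*%R/1]_(v \in [set v : K -> R | finite_place v]) Num.max 1 (v x) = a%:R &
  forall v : K -> R, finite_place v -> v (a%:R * x) <= 1].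
Proof.
have /choice[g gP] : forall v : K -> R, exists n : nat, finite_place v ->
    [/\ (0 < n)%N, Num.max 1 (v x) = n%:R & v (n%:R * x) <= 1].
  move=> v; have [pv|npv] := pselect (finite_place v); last by exists 0%N.
  have [vx|vx] := leP (v x) 1.
    by exists 1%N => _; rewrite mul1r.
  have [n [n0 vn vnx]] := place_denominator pv vx; exists n => _; split=> //.
  by rewrite (placeM pv) -ler_pdivlMr ?(lt_trans ltr01 vx) // mul1r.
set A := [set v : K -> R | finite_place v].
set S := fset_set [set v : K -> R | finite_place v /\ 1 < v x].
have SE v : v \in finmap.enum_fset S -> finite_place v.
  by rewrite in_fset_set ?inE; [case|exact: finite_poles].
exists (\prod_(v <- finmap.enum_fset S) g v)%N; split.
- rewrite big_seq; apply: prodn_cond_gt0 => v /SE pv.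
  by have [] := gP v pv.
- rewrite (@fsbigE _ _ _ _ _ (finmap.enum_fset S)).
  + rewrite natr_prod big_seq_cond [RHS]big_seq; apply: eq_big.
      by move=> v; apply/andb_idr => /SE; apply: mem_set.
    by move=> v /andP[/SE pv _]; have [] := gP v pv.
  + exact: finmap.fset_uniq.
  + by move=> v /SE.
  + move=> v pv nS; apply/max_l; rewrite leNgt; apply: contra nS => vx.
    by rewrite in_fset_set ?inE //; apply: finite_poles.
- move=> v pv; have [vS|nS] := boolP (v \in finmap.enum_fset S).
    rewrite (big_rem v) //= natrM mulrAC mulrC.
    rewrite (placeM pv) mulr_ile1 ?(place_ge0 pv) ?(place_nat pv) //.
    by have [_ _] := gP v pv.
  rewrite (placeM pv) mulr_ile1 ?(place_ge0 pv) ?(place_nat pv) //.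
  rewrite leNgt; apply: contra nS => vx.
  by rewrite in_fset_set ?inE //; apply: finite_poles.
Qed.

End PlaceFamilies.

(** * Embeddings and norms *)

Section ComplexNorm.
Variable R : realType.
Implicit Types z : R[i].

(** The absolute value of a complex number as an element of [R]. *)
Definition cnorm z : R := complex.Re `|z|.

Lemma cnormE z : (cnorm z)%:C%C = `|z|.
Proof. by rewrite /cnorm RRe_real // ger0_real. Qed.
Lemma cnormM : {morph cnorm : z w / z * w}.
Proof.
move=> z w; have : (cnorm (z * w))%:C%C = (cnorm z * cnorm w)%:C%C.
  by rewrite rmorphM /= !cnormE normrM.
by case.
Qed.
Lemma le_cnorm (a : R) z : (cnorm z <= a) = (`|z| <= a%:C%C).
Proof. by rewrite -cnormE lecR. Qed.
Lemma cnorm_ge0 z : 0 <= cnorm z.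
Proof. by rewrite -lecR cnormE normr_ge0. Qed.
Lemma cnorm1 : cnorm 1 = 1.
Proof. by rewrite /cnorm normr1. Qed.
Lemma cnorm_real (x : R) : cnorm x%:C%C = `|x|.
Proof. by rewrite /cnorm normc_def /= expr0n addr0 sqrtr_sqr. Qed.
Lemma cnorm_prod (I : Type) (s : seq I) (P : pred I) (F : I -> R[i]) :
  cnorm (\prod_(i <- s | P i) F i) = \prod_(i <- s | P i) cnorm (F i).
Proof. exact: (big_morph _ cnormM cnorm1). Qed.

End ComplexNorm.

Lemma rat_integral_int (r : rat) (C : numClosedFieldType) :
  integralOver (intr : int -> C) (ratr r) -> exists c : int, r = c%:~R.
Proof.
move=> [p monp]; have -> : map_poly intr p = map_poly ratr (map_poly intr p) :> {poly C}.
  by rewrite -map_poly_comp; apply: eq_map_poly => c; rewrite /= ratr_int.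
rewrite fmorph_root => rp.
have : (ratr r : algC) \is a Num.int.
  apply: Cint_rat_Aint; first exact: Crat_rat.
  apply: (@root_monic_Aint (map_poly intr p)).
  - rewrite (_ : map_poly intr p = map_poly ratr (map_poly intr p)) ?fmorph_root //.
    by rewrite -map_poly_comp; apply: eq_map_poly => c; rewrite /= ratr_int.
  - exact: monic_map.
  - by apply/polyOverP => i; rewrite coef_map intr_int.
move=> /intrP[c rc].
by exists c; move: rc; rewrite -(ratr_int algC c) => /fmorph_inj.
Qed.

Section Embeddings.
Variables (R : realType) (K : fieldExtType rat).
Let C := R[i].
Let d := \dim {:K}.

Lemma complex_embeddingP (s : K -> C) : zmod_morphism s -> monoid_morphism s ->
  complex_embedding s.
Proof.
move=> sB sM.
pose a := GRing.isZmodMorphism.Build K C s sB.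
pose m := GRing.isMonoidMorphism.Build K C s sM.
pose f : {rmorphism K -> C} := HB.pack s a m.
by exists f.
Qed.

Lemma primitive_element : exists theta : K, <<1; theta>>%VS = fullv.
Proof.
exists (separable_generator 1%AS {:K}%AS); symmetry.
apply: (eq_adjoin_separable_generator (E := {:K}%AS) (K := 1%AS)); last exact: subvf.
apply/separableP => x _; apply: pcharf0_separable => p.
by rewrite pchar_lalg pchar_num.
Qed.

(** The conjugates of a primitive element [theta] are the roots of its minimal
    polynomial over the rationals; evaluation at each of them is an embedding. *)
Lemma embeddings_exist : exists (theta : K) (sigma : 'I_d -> K -> C),
  [/\ <<1; theta>>%VS = fullv, forall i, complex_embedding (sigma i),
      injective (fun i => sigma i theta) &
      forall s, complex_embedding s -> exists i, s = sigma i].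
Proof.
have [theta genK] := primitive_element.
have /polyOver1P[p pE] : minPoly 1%VS theta \is a polyOver 1%VS.
  exact: minPolyOver.
have szp : size p = d.+1.
  have := size_minPoly 1%VS theta; rewrite pE size_map_poly => ->.
  by rewrite adjoin_degreeE genK dimv1 divn1.
have sep : separable_poly p.
  rewrite -(separable_map (in_alg K)) -pE.
  by apply: pcharf0_separable => q; rewrite pchar_lalg pchar_num.
have monp : p \is monic by rewrite -(map_monic (in_alg K)) -pE monic_minPoly.
have [rs] := closed_field_poly_normal (map_poly ratr p : {poly C}).
rewrite lead_coef_map (monicP monp) rmorph1 scale1r => rsE.
have uniq_rs : uniq rs by rewrite -separable_prod_XsubC -rsE separable_map.
have size_rs : size rs = d.
  by apply/succn_inj; rewrite -(size_prod_XsubC rs id) -rsE size_map_poly szp.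
have rootE z : (z \in rs) = root (map_poly ratr p) z by rewrite rsE root_prod_XsubC.
pose z (i : 'I_d) := rs`_i.
have zP i : root (map_poly ratr p) (z i) by rewrite -rootE mem_nth ?size_rs.
have /choice[rep repP] : forall y, exists q : {poly rat},
    (map_poly (in_alg K) q).[theta] = y.
  move=> y; have /Fadjoin_polyP[q /polyOver1P[q' ->] ->] : y \in <<1; theta>>%VS.
    by rewrite genK memvf.
  by exists q'.
pose sigma i y := (map_poly ratr (rep y)).[z i].
have ev i q : sigma i (map_poly (in_alg K) q).[theta] = (map_poly ratr q).[z i].
  apply/eqP; rewrite -subr_eq0 -hornerN -hornerD -rmorphB /=.
  have /(dvdpP)[g ->] : p %| (rep (map_poly (in_alg K) q).[theta] - q).
    rewrite -(dvdp_map (in_alg K)) -pE; apply: minPoly_dvdp.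
      by apply/polyOver1P; eexists.
    by rewrite /root rmorphB hornerD hornerN repP subrr.
  by rewrite rmorphM hornerM (eqP (zP i)) mulr0.
exists theta, sigma; split=> //.
- move=> i; apply: complex_embeddingP.
    move=> x y; rewrite -{1}[x]repP -{1}[y]repP -hornerN -hornerD -rmorphB /= ev.
    by rewrite rmorphB hornerD hornerN.
  split; first by have := ev i 1%:P; rewrite !map_polyC !hornerC /= scale1r rmorph1.
  move=> x y; rewrite -{1}[x]repP -{1}[y]repP -hornerM -rmorphM /= ev.
  by rewrite rmorphM hornerM.
- move=> i j; rewrite /= -(hornerX theta) -(map_polyX (in_alg K)) !ev map_polyX !hornerX.
  by move=> /eqP; rewrite nth_uniq ?size_rs // => /eqP/val_inj.
- move=> s [f ->].
  have fE q : f (map_poly (in_alg K) q).[theta] = (map_poly ratr q).[f theta].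
    rewrite -horner_map -map_poly_comp; congr (_.[_]); apply: eq_map_poly => c /=.
    by rewrite rmorphZ_num rmorph1 mulr1.
  have : f theta \in rs.
    by rewrite rootE /root -fE -pE (eqP (root_minPoly _ _)) rmorph0.
  move=> /(nthP 0)[i lti zi]; rewrite size_rs in lti; exists (Ordinal lti).
  by apply/funext => y; rewrite -[y]repP ev fE -zi.
Qed.

(** The matrix of the multiplication by [y] in the basis of powers of a
    primitive element is diagonalized by the Vandermonde matrix of its
    conjugates. *)
Lemma norm_ge1 y : y != 0 -> integralOver (intr : int -> K) y ->
  forall (theta : K) (sigma : 'I_d -> K -> C), <<1; theta>>%VS = fullv ->
  (forall i, complex_embedding (sigma i)) -> injective (fun i => sigma i theta) ->
  1 <= \prod_i cnorm (sigma i y).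
Proof.
move=> y0 inty theta sigma genK emb inj.
have [f fE] := choice emb.
have fK i x : sigma i x = f i x by rewrite fE.
have /choice[m mP] : forall j : 'I_d, exists m : 'I_d -> rat,
    theta ^+ j * y = \sum_k m k *: theta ^+ k.
  move=> j; have yK : theta ^+ j * y \in <<1%AS; theta>>%VS by rewrite genK memvf.
  have := size_Fadjoin_poly 1%VS theta (theta ^+ j * y).
  have /polyOver1P[q qE] := Fadjoin_polyOver 1%VS theta (theta ^+ j * y).
  rewrite adjoin_degreeE genK dimv1 divn1 => leq.
  exists (fun k => q`_k); rewrite -(Fadjoin_poly_eq yK) (horner_coef_wide _ leq) qE.
  by apply: eq_bigr => k _; rewrite coef_map /= mulr_algl.
pose M : 'M[rat]_d := \matrix_(j, k) m j k.
pose W : 'M[C]_d := Vandermonde d (\row_i sigma i theta).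
have detW : \det W != 0.
  rewrite det_Vandermonde; apply/prodf_neq0 => i _; apply/prodf_neq0 => j ij.
  rewrite !mxE subr_eq0 (inj_eq inj); apply: contraTneq ij => ->.
  by rewrite ltnn.
have MW : map_mx ratr M *m W = W *m diag_mx (\row_i sigma i y).
  apply/matrixP => j i; rewrite mul_mx_diag !mxE !fK -rmorphXn -rmorphM /= mP.
  rewrite rmorph_sum; apply: eq_bigr => k _; rewrite !mxE fK rmorphZ_num.
  by rewrite rmorphXn.
have detM : ratr (\det M) = \prod_i sigma i y.
  apply: (mulIf detW); rewrite -det_map_mx -det_mulmx MW det_mulmx det_diag mulrC.
  by congr (_ * _); apply: eq_bigr => i _; rewrite mxE.
have [c cE] : exists c : int, \det M = c%:~R.
  apply: (@rat_integral_int _ C); rewrite detM.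
  apply: big_ind => [|? ?|i _]; [exact: integral1|exact: integral_mul|].
  have := integral_rmorph (f i) inty; rewrite fK; case=> p monp rp; exists p => //.
  rewrite (_ : map_poly intr p = map_poly (f i \o intr) p) //.
  by apply: eq_map_poly => c; rewrite /= rmorph_int.
rewrite -cnorm_prod -detM cE ratr_int -(rmorph_int (real_complex R)) cnorm_real.
rewrite -intr_norm ler1z -gtz0_ge1 normr_gt0.
have : \prod_i sigma i y != 0 by apply/prodf_neq0 => i _; rewrite fK fmorph_eq0.
by rewrite -detM cE ratr_int; apply: contraNneq => ->.
Qed.
End Embeddings.

(** * A lower bound for determinants of monomials *)

Section Liouville.
Variables (R : realType) (K : fieldExtType rat).
Let C := R[i].
Let d := \dim {:K}.

Lemma prod_ge1 (I : finType) (F : I -> R) :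
  (forall i, 1 <= F i) -> 1 <= \prod_i F i.
Proof. by move=> F1; elim/big_ind: _ => // x y; apply: mulr_ege1. Qed.

Lemma height_factors (sigma : 'I_d -> K -> C) : injective sigma ->
  (forall i, complex_embedding (sigma i)) ->
  (forall s, complex_embedding s -> exists i, s = sigma i) ->
  forall x (T : R), weil_height R x <= T -> exists a : nat, [/\ (0 < a)%N,
    a%:R * \prod_i Num.max 1 (cnorm (sigma i x)) <= T ^+ d &
    forall v : K -> R, finite_place v -> v (a%:R * x) <= 1].
Proof.
move=> inj emb surj x T hx; have [a [a0 aE av]] := height_denominator R x.
exists a; split=> //; move: hx; rewrite /weil_height aE.
have -> : \big[*%R/1]_(s \in [set s : K -> C | complex_embedding s])
    Num.max 1 (complex.Re `|s x|) = \prod_i Num.max 1 (cnorm (sigma i x)).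
  rewrite (@fsbigE _ _ _ _ _ [seq sigma i | i <- enum 'I_d]).
  - rewrite big_map big_enum_cond /=; apply: eq_bigl => i.
    by rewrite mem_set //; apply: emb.
  - by rewrite map_inj_uniq ?enum_uniq.
  - by move=> s /mapP[i _ ->]; apply: emb.
  - by move=> s /surj[i ->] /negP[]; apply: map_f; rewrite mem_enum.
rewrite mulrC => le_T; have d0 : (0 < d)%N by apply: adim_gt0.
have P0 : 0 <= a%:R * \prod_i Num.max 1 (cnorm (sigma i x)).
  by rewrite mulr_ge0 ?prodr_ge0 // => i _; rewrite le_max ler01.
have := @lerXn2r R d _ _ _ _ le_T.
rewrite !nnegrE powR_ge0 => /(_ isT (le_trans (powR_ge0 _ _) le_T)).
by rewrite -(powR_mulrn d (powR_ge0 _ _)) -powRrM mulVf ?powRr1 // pnatr_eq0 -lt0n.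
Qed.

(** After multiplication by the denominators [a ^ D] of its rows, [delta] has
    norm at least 1; the conjugates other than [iota] are bounded by the
    Leibniz formula, and the denominators and the archimedean factors together
    by the heights. *)
Lemma det_monomials_lower_bound (iota : {rmorphism K -> R}) n D L (T : R)
    (y : 'I_L -> 'I_n -> K) (e : 'I_L -> 'I_n -> nat) :
  1 <= T -> (forall p l, weil_height R (y p l) <= T) ->
  (forall j l, (e j l <= D)%N) ->
  let delta := \det (\matrix_(p, j) \prod_l y p l ^+ e j l) in
  delta != 0 ->
  1 <= `|iota delta| * (L`!)%:R ^+ d * T ^+ (d ^ 2 * D * (L * n)).
Proof.
move=> T1 hy eD delta delta0.
have [theta [sigma [genK emb injt surj]]] := embeddings_exist R K.
have inj : injective sigma by move=> i j sij; apply: injt; rewrite sij.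
have [f fE] := choice emb.
have /choice[a aP] := fun pl : 'I_L * 'I_n => height_factors inj emb surj (hy pl.1 pl.2).
pose b p := (\prod_l a (p, l) ^ D)%N.
pose B := (\prod_p b p)%N.
pose delta' := B%:R * delta.
have delta'E : delta' = \det (\matrix_(p, j) ((b p)%:R * \prod_l y p l ^+ e j l)).
  rewrite /delta' /delta /B natr_prod.
  transitivity (\det (diag_mx (\row_p (b p)%:R)) * delta).
    by rewrite det_diag; congr (_ * _); apply: eq_bigr => p _; rewrite mxE.
  rewrite -det_mulmx; congr (\det _); apply/matrixP => p j.
  by rewrite mul_diag_mx !mxE.
have B0 : (0 < B)%N.
  by apply: prodn_gt0 => p; apply: prodn_gt0 => l; rewrite expn_gt0; case: (aP (p, l)) => ->.
have delta'0 : delta' != 0 by rewrite mulf_neq0 // natK_neq0.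
have int_delta' : integralOver (intr : int -> K) delta'.
  apply: (@integral_of_places R) => v pv; rewrite delta'E.
  apply: (place_sum pv) => // s _; rewrite (placeM pv) (placeX pv) (placeN pv) (place1 pv).
  rewrite expr1n mul1r; apply: (big_ind (fun z => v z <= 1)) => [|z w|p _].
  - by rewrite (place1 pv).
  - by rewrite (placeM pv) => *; apply: mulr_ile1; rewrite ?(place_ge0 pv).
  rewrite mxE natr_prod -big_split /=.
  apply: (big_ind (fun z => v z <= 1)) => [|z w|l _].
  - by rewrite (place1 pv).
  - by rewrite (placeM pv) => *; apply: mulr_ile1; rewrite ?(place_ge0 pv).
  rewrite natrX -(subnK (eD (s p) l)) exprD -mulrA -exprMn.
  rewrite (placeM pv) !(placeX pv) mulr_ile1 ?exprn_ge0 ?(place_ge0 pv) //.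
    by rewrite exprn_ile1 ?(place_ge0 pv) ?(place_nat pv).
  by rewrite exprn_ile1 ?(place_ge0 pv) //; have [_ _] := aP (p, l); apply.
have norm1 := norm_ge1 delta'0 int_delta' genK emb injt.
pose Mx i p l := Num.max 1 (cnorm (sigma i (y p l))).
pose U i := B%:R * ((L`!)%:R * \prod_p \prod_l Mx i p l ^+ D).
have Mx1 i p l : 1 <= Mx i p l by rewrite le_max lexx.
have upper i : cnorm (sigma i delta') <= U i.
  have fE' x : sigma i x = f i x by rewrite fE.
  rewrite fE' /delta' rmorphM rmorph_nat cnormM /U.
  rewrite (_ : cnorm B%:R = B%:R); last first.
    by rewrite -(rmorph_nat (real_complex R)) cnorm_real ger0_norm.
  rewrite ler_wpM2l // /delta -det_map_mx le_cnorm rmorphM rmorph_nat rmorph_prod.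
  apply: det_bound => p j; rewrite !mxE rmorph_prod normr_prod rmorph_prod.
  apply: ler_prod => l _; rewrite normr_ge0 /= rmorphXn normrX -cnormE -rmorphXn lecR.
  rewrite -fE'; apply: le_trans (_ : Mx i p l ^+ e j l <= _).
    by rewrite lerXn2r ?nnegrE ?cnorm_ge0 ?(le_trans ler01) // le_max lexx orbT.
  exact: ler_weXn2l.
have [i0 i0E] : exists i, sigma i = (fun x => (iota x)%:C%C).
  have [|i iE] := surj (fun x => (iota x)%:C%C); last by exists i.
  by exists (real_complex R \o iota).
have U1 i : 1 <= U i.
  rewrite /U; apply: mulr_ege1; first by rewrite ler1n.
  apply: mulr_ege1; first by rewrite ler1n fact_gt0.
  by do 2![apply: prod_ge1 => ?]; apply: exprn_ege1.
have iota_delta' : cnorm (sigma i0 delta') = B%:R * `|iota delta|.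
  by rewrite i0E cnorm_real rmorphM rmorph_nat normrM ger0_norm.
apply: le_trans norm1 _; rewrite (bigD1 i0) //= iota_delta'.
apply: le_trans (_ : B%:R * `|iota delta| * \prod_(i | i != i0) U i <= _).
  rewrite ler_wpM2l ?mulr_ge0 //; apply: ler_prod => i _.
  by rewrite cnorm_ge0 upper.
apply: le_trans (_ : `|iota delta| * \prod_i U i <= _).
  rewrite (_ : \prod_i U i = U i0 * \prod_(i | i != i0) U i); last by rewrite (bigD1 i0).
  rewrite [B%:R * _]mulrC -mulrA ler_wpM2l // ler_wpM2r //.
    by apply: prodr_ge0 => i _; apply: le_trans (U1 i).
  rewrite /U ler_peMr //; apply: mulr_ege1; first by rewrite ler1n fact_gt0.
  by do 2![apply: prod_ge1 => ?]; apply: exprn_ege1.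
rewrite -mulrA ler_wpM2l //.
have -> : \prod_i U i = (L`!)%:R ^+ d *
    \prod_p \prod_l ((a (p, l))%:R ^+ d * \prod_i Mx i p l) ^+ D.
  rewrite /U !big_split /= !prodr_const card_ord mulrCA; congr (_ * _).
  rewrite exchange_big /= /B natr_prod -prodrXl -big_split /=; apply: eq_bigr => p _.
  rewrite exchange_big /= /b natr_prod -prodrXl -big_split /=; apply: eq_bigr => l _.
  by rewrite exprMn -prodrXl natrX -!exprM mulnC.
rewrite ler_wpM2l ?exprn_ge0 //.
have -> : T ^+ (d ^ 2 * D * (L * n)) = \prod_(p < L) \prod_(l < n) T ^+ (d ^ 2 * D).
  by rewrite !prodr_const !card_ord -!exprM [(n * L)%N]mulnC mulnA.
apply: ler_prod => p _; apply/andP; split.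
  by apply: prodr_ge0 => l _; rewrite exprn_ge0 // mulr_ge0 ?exprn_ge0 ?prodr_ge0 // => i _;
    apply: le_trans (Mx1 i p l).
apply: ler_prod => l _; apply/andP; split.
  by rewrite exprn_ge0 // mulr_ge0 ?exprn_ge0 ?prodr_ge0 // => i _; apply: le_trans (Mx1 i p l).
have T0 : 0 <= T by apply: le_trans T1.
have aM0 : 0 <= (a (p, l))%:R ^+ d * \prod_i Mx i p l.
  by rewrite mulr_ge0 ?exprn_ge0 ?prodr_ge0 // => i _; apply: le_trans (Mx1 i p l).
rewrite exprM; apply: lerXn2r; rewrite ?nnegrE ?exprn_ge0 //.
have [_ leT _] := aP (p, l).
have d0 : (0 < d)%N by apply: adim_gt0.
have PM1 : 1 <= \prod_i Mx i p l by apply: prod_ge1.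
rewrite expnS expn1 exprM.
apply: le_trans (_ : (a (p, l))%:R ^+ d * (\prod_i Mx i p l) ^+ d <= _).
  by rewrite ler_wpM2l ?exprn_ge0 // -[X in X <= _]expr1 ler_weXn2l.
rewrite -exprMn lerXn2r ?nnegrE ?exprn_ge0 //.
by rewrite mulr_ge0 // (le_trans ler01).
Qed.

End Liouville.

(** * Taylor expansion *)

Section TaylorOneVariable.
Variable R : realType.
Implicit Types (f g F : R -> R) (u : nat -> R -> R).

Lemma is_derive_le f F f' F' (t : R) : 0 <= t ->
  (forall s, 0 <= s <= t -> is_derive s 1 f (f' s)) ->
  (forall s, 0 <= s <= t -> is_derive s 1 F (F' s)) ->
  (forall s, 0 <= s <= t -> f' s <= F' s) ->
  f t - f 0 <= F t - F 0.
Proof.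
move=> t0 df dF le'; rewrite -subr_ge0.
have dg s : 0 <= s <= t -> is_derive s 1 (F - f) (F' s - f' s).
  by move=> st; apply: is_deriveB; [apply: dF|apply: df].
have [||c] := @MVT_segment R (F - f) (fun s => F' s - f' s) 0 t t0.
- by move=> s; rewrite in_itv /= => /andP[s0 st]; apply: dg; rewrite !ltW.
- apply: derivable_within_continuous => s; rewrite in_itv /= => st.
  by have [] := dg s st.
rewrite in_itv /= !fctE => cs e.
have : 0 <= (F' c - f' c) * (t - 0) by rewrite mulr_ge0 ?subr_ge0 ?le'.
by rewrite -e; congr (_ <= _); ring.
Qed.

(** By induction on [N]: the derivative of the remainder is the remainder of
    order [N - 1] of the derivative. *)
Lemma taylor_bound N u (B t : R) : 0 <= t ->
  (forall m s, (m < N)%N -> 0 <= s <= t -> is_derive s 1 (u m) (u m.+1 s)) ->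
  (forall s, 0 <= s <= t -> `|u N s| <= B) ->
  `|u 0%N t - \sum_(m < N) u m 0 * t ^+ m / (m`!)%:R| <= B * t ^+ N / (N`!)%:R.
Proof.
elim: N u t => [|N IH] u t t0 du uB.
  by rewrite big_ord0 subr0 expr0 mulr1 divr1; apply: uB; rewrite t0 lexx.
pose g s := u 0%N s - \sum_(m < N.+1) u m 0 * s ^+ m / (m`!)%:R.
pose g' s := u 1%N s - \sum_(m < N) u m.+1 0 * s ^+ m / (m`!)%:R.
pose F s := B * s ^+ N.+1 / (N.+1`!)%:R.
pose F' s := B * s ^+ N / (N`!)%:R.
have pow_derive (m : nat) (c s : R) :
    is_derive s 1 (fun s => c * s ^+ m.+1 / (m.+1`!)%:R) (c * s ^+ m / (m`!)%:R).
  have := is_deriveZ (c / (m.+1`!)%:R) (is_deriveX m.+1 (is_derive_id s 1)).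
  congr is_derive.
    by apply/funext => x /=; rewrite /GRing.scale /= !fctE; ring.
  rewrite /GRing.scale /= factS natrM; field.
  by rewrite nat1r !pnatr_eq0 -lt0n fact_gt0.
have dg s : 0 <= s <= t -> is_derive s 1 g (g' s).
  move=> st; rewrite /g'.
  have -> : g = u 0%N - (fun s => \sum_(m < N.+1) u m 0 * s ^+ m / (m`!)%:R) by [].
  apply: is_deriveB; first exact: du.
  have -> : (fun s => \sum_(m < N.+1) u m 0 * s ^+ m / (m`!)%:R) =
      \sum_(m < N.+1) (fun s => u m 0 * s ^+ m / (m`!)%:R).
    by apply/funext => x; rewrite fct_sumE.
  have -> : \sum_(m < N) u m.+1 0 * s ^+ m / (m`!)%:R = \sum_(m < N.+1)
      (if (m : nat) is m'.+1 then u m'.+1 0 * s ^+ m' / (m'`!)%:R else 0) :> R.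
    by rewrite big_ord_recl add0r.
  apply: is_derive_sum => -[[|m] ltm] /=; last exact: pow_derive.
  by under eq_fun do rewrite expr0; apply: is_derive_cst.
have g0 : g 0 = 0.
  rewrite /g big_ord_recl expr0 mulr1 divr1 big1 ?addr0 ?subrr // => i _.
  by rewrite lift0 expr0n mulr0 mul0r.
have F0 : F 0 = 0 by rewrite /F expr0n mulr0 mul0r.
have le' s : 0 <= s <= t -> `|g' s| <= F' s.
  move=> /andP[s0 st]; apply: (IH (fun m => u m.+1)) => //.
    by move=> m x ltm /andP[x0 xs]; apply: du => //; rewrite x0 (le_trans xs).
  by move=> x /andP[x0 xs]; apply: uB; rewrite x0 (le_trans xs).
have dF s : 0 <= s <= t -> is_derive s 1 F (F' s) by move=> _; apply: pow_derive.
rewrite -/(g t) -/(F t) ler_norml; apply/andP; split.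
  have : (- g) t - (- g) 0 <= F t - F 0.
    apply: (@is_derive_le (- g) F (fun s => - g' s) F') => // s st.
      by apply: is_deriveN; apply: dg.
    by rewrite lerNl; have := le' s st; rewrite ler_norml => /andP[].
  by rewrite F0 subr0 lerNl; apply: le_trans; rewrite !fctE g0 oppr0 subr0.
have : g t - g 0 <= F t - F 0.
  apply: (@is_derive_le _ _ g' F') => // s st.
  by have := le' s st; rewrite ler_norml => /andP[].
by rewrite F0 g0 !subr0.
Qed.
End TaylorOneVariable.

(** Products of power series with coefficients bounded by [a ^ i] and [b ^ i]
    have coefficients bounded by [(a + b) ^ i]. *)
Lemma sum_expr_le (R : realFieldType) (a b : R) m : 0 <= a -> 0 <= b ->
  \sum_(i < m.+1) a ^+ i * b ^+ (m - i) <= (a + b) ^+ m.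
Proof.
move=> a0 b0; rewrite addrC exprDn; apply: ler_sum => i _; rewrite mulrC.
rewrite -[X in X <= _]mulr1n ler_wpMn2l ?mulr_ge0 ?exprn_ge0 // bin_gt0.
exact: leq_ord.
Qed.

Lemma sum_triangle (V : nmodType) (a : nat -> nat -> V) N :
  \sum_(M < N) \sum_(m < M.+1) a m (M - m)%N =
  \sum_(m < N) \sum_(l < N - m) a m l.
Proof.
elim: N => [|N IH]; first by rewrite !big_ord0.
rewrite big_ord_recr /= IH [RHS]big_ord_recr /= subSnn big_ord1 [X in _ + X]big_ord_recr /=.
rewrite addrA subnn -big_split /=; congr (_ + _); apply: eq_bigr => m _.
by rewrite subSn ?(ltnW (ltn_ord m)) // big_ord_recr.
Qed.

Section MsizeBounds.
Variables (R : idomainType) (k : nat).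
Implicit Types p q : mpoly.mpoly k R.

Lemma msizeM_leq p q a b : (mpoly.msize p <= a.+1)%N -> (mpoly.msize q <= b.+1)%N ->
  (mpoly.msize (p * q) <= (a + b).+1)%N.
Proof.
have [->|p0] := eqVneq p 0; first by rewrite mul0r mpoly.msize0.
have [->|q0] := eqVneq q 0; first by rewrite mulr0 mpoly.msize0.
by rewrite mpoly.msizeM //; lia.
Qed.

Lemma msize_sum_leq (I : finType) (F : I -> mpoly.mpoly k R) a :
  (forall i, (mpoly.msize (F i) <= a)%N) -> (mpoly.msize (\sum_i F i) <= a)%N.
Proof.
by move=> leF; apply: leq_trans (mpoly.msize_sum _ _ _) _; apply/bigmax_leqP.
Qed.

End MsizeBounds.

Section TaylorCube.
Variables (R : realType) (k : nat) (f : 'rV[R]_k -> R).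
Implicit Types (mu : 'I_k -> nat) (z x : 'rV[R]_k).

Definition mu_add mu (j : 'I_k) (m : nat) (i : 'I_k) : nat := (mu i + (i == j) * m)%N.

(** [multi_partial] applies the derivatives in the last variables first, so a
    derivative in [x_j] can be added in front when there is none in the
    variables before [x_j]; no symmetry of the derivatives is involved. *)
Lemma multi_partial_add1 mu (j : 'I_k) m :
  (forall i : 'I_k, (i < j)%N -> mu i = 0%N) ->
  multi_partial (mu_add mu j m.+1) f =
  (fun z => 'D_('e_j) (multi_partial (mu_add mu j m) f) z).
Proof.
move=> mu0; rewrite /multi_partial.
suff -> : flatten [seq nseq (mu_add mu j m.+1 i) i | i <- enum 'I_k] =
    j :: flatten [seq nseq (mu_add mu j m i) i | i <- enum 'I_k] by [].
have : sorted (fun a b : 'I_k => a < b)%N (enum 'I_k).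
  by have := iota_ltn_sorted 0 k; rewrite -val_enum_ord sorted_map.
have : j \in enum 'I_k by rewrite mem_enum.
elim: (enum 'I_k) => // i s IH; rewrite inE => js.
rewrite /= path_sortedE; last by move=> ? ? ?; apply: ltn_trans.
move=> /andP[/allP lti sor]; have [ij|ij] := eqVneq i j.
  rewrite ij /mu_add eqxx !mul1n addnS /=; congr (_ :: _ ++ flatten _).
  apply/eq_in_map => l ls; have := lti l ls; rewrite ij.
  by case: eqP => [->|//]; rewrite ltnn.
rewrite eq_sym (negPf ij) /= in js.
rewrite /mu_add (negPf ij) !mul0n mu0 ?lti //=; exact: IH.
Qed.

Lemma is_derive_line (F : 'rV[R]_k -> R) v x (s : R) :
  derivable F (s *: v + x) v ->
  is_derive s 1 (fun s => F (s *: v + x)) ('D_v F (s *: v + x)).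
Proof.
have e : (fun h : R => h^-1 *: (((fun s => F (s *: v + x)) \o shift s) (h *: (1 : R)) -
      F (s *: v + x))) =
    (fun h : R => h^-1 *: ((F \o shift (s *: v + x)) (h *: v) - F (s *: v + x))).
  apply/funext => h /=; congr (_ *: (F _ - _)).
  by rewrite (_ : h *: (1 : R) = h) ?scalerDl ?addrA //; apply: mulr1.
by move=> dF; split; [rewrite /derivable e|rewrite /derive e].
Qed.

Hypothesis smooth : smooth_on_cube f.
Variables (beta : nat) (tau0 : R).
Hypothesis tau0_ge0 : 0 <= tau0.
Definition mu_size mu := (\sum_i mu i)%N.
Definition mu_fact mu := (\prod_i (mu i)`!)%N.
Hypothesis bound : forall mu z, unit_cube z -> (mu_size mu <= beta)%N ->
  `|multi_partial mu f z| <= (mu_fact mu)%:R * tau0 ^+ mu_size mu.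

Lemma mu_size_add mu j m : mu_size (mu_add mu j m) = (mu_size mu + m)%N.
Proof.
rewrite /mu_size /mu_add big_split /=; congr (_ + _)%N.
rewrite (bigD1 j) //= eqxx mul1n big1 ?addn0 //.
by move=> i /negPf ->.
Qed.

Lemma mu_fact_add mu (j : 'I_k) m : mu j = 0%N ->
  mu_fact (mu_add mu j m) = (mu_fact mu * m`!)%N.
Proof.
move=> muj; rewrite /mu_fact /mu_add (bigD1 j) //= [in RHS](bigD1 j) //=.
rewrite muj eqxx mul1n fact0 mul1n mulnC; congr (_ * _)%N.
by apply: eq_bigr => i /negPf ->; rewrite addn0.
Qed.

Lemma taylor_coord mu (j : 'I_k) N x (h : R) :
  (forall i : 'I_k, (i <= j)%N -> mu i = 0%N) -> (N + mu_size mu <= beta)%N ->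
  (forall t : R, 0 <= t <= 1 -> unit_cube ((t * h) *: 'e_j + x)) ->
  `|multi_partial mu f (h *: 'e_j + x) -
     \sum_(m < N) multi_partial (mu_add mu j m) f x * h ^+ m / (m`!)%:R| <=
  (mu_fact mu)%:R * tau0 ^+ mu_size mu * (tau0 * `|h|) ^+ N.
Proof.
move=> mu0 leN cube.
pose u m (t : R) := h ^+ m * multi_partial (mu_add mu j m) f ((t * h) *: 'e_j + x).
have du (m : nat) (s : R) : 0 <= s <= 1 -> is_derive s 1 (u m) (u m.+1 s).
  move=> s01; pose F := multi_partial (mu_add mu j m) f.
  have dF := (smooth (flatten [seq nseq (mu_add mu j m i) i | i <- enum 'I_k])
              (cube s s01)).2 j.
  have dl := is_derive_line dF.
  have dh : is_derive s 1 (fun t : R => t * h) h.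
    have := is_deriveZ h (is_derive_id s (1 : R)); congr is_derive.
      by apply/funext => t; rewrite /= mulrC.
    by rewrite /GRing.scale /= mulr1.
  have := is_deriveZ (h ^+ m) (@is_derive1_comp R (fun s => F (s *: 'e_j + x)) ( *%R^~ h) s _ _ dl dh).
  congr is_derive; rewrite /u multi_partial_add1; last by move=> i /ltnW/mu0.
  by rewrite exprSr -mulrA; congr (_ * _); rewrite mulrC.
have uN (s : R) : 0 <= s <= 1 -> `|u N s| <= (mu_fact mu)%:R * tau0 ^+ mu_size mu *
    (tau0 * `|h|) ^+ N * (N`!)%:R.
  move=> s01; rewrite /u normrM normrX.
  have := bound (mu := mu_add mu j N) (cube s s01).
  rewrite mu_size_add addnC => /(_ leN) b.
  apply: le_trans (ler_wpM2l (exprn_ge0 _ (normr_ge0 _)) b) _.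
  rewrite mu_fact_add ?mu0 // natrM exprD exprMn.
  by rewrite le_eqVlt; apply/orP; left; apply/eqP; ring.
have := taylor_bound (t := 1) ler01 (fun m s _ => @du m s) uN.
rewrite /u expr0 !mul1r expr1n mulr1 mulfK; last by rewrite pnatr_eq0 -lt0n fact_gt0.
have -> : mu_add mu j 0 = mu.
  by apply/funext => i; rewrite /mu_add muln0 addn0.
congr (`|_ - _| <= _); apply: eq_bigr => m _.
by rewrite mul0r scale0r add0r expr1n mulr1 [h ^+ m * _]mulrC.
Qed.
Variables (c : 'rV[R]_k) (r : R).
Hypothesis cube_c : unit_cube c.
Hypothesis r_ge0 : 0 <= r.

(** Only the part of the box in the open cube, where [f] is controlled. *)
Definition in_box z := unit_cube z /\ forall i, `|z ord0 i - c ord0 i| <= r.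

Definition box_eval z (p : mpoly.mpoly k R) : R :=
  mpoly.meval (fun i => z ord0 i - c ord0 i) p.

Lemma box_evalX z i : box_eval z (mpoly.mpolyX R (mpoly.mnm1 i)) = z ord0 i - c ord0 i.
Proof. exact: mpoly.mevalXU. Qed.

(** The point with the first [j] coordinates of [z] and the others of [c]. *)
Definition mixed_point (j : nat) z : 'rV[R]_k :=
  \row_i (if (i < j)%N then z ord0 i else c ord0 i).

Let tau := tau0 * r.

(** Taylor expansion in the first [j] variables, the last of them first: this
    is the order in which [multi_partial] takes the derivatives. *)
Lemma taylor_prefix (j : nat) mu N : (j <= k)%N ->
  (forall i : 'I_k, (i < j)%N -> mu i = 0%N) -> (N + mu_size mu <= beta)%N ->
  let G := (mu_fact mu)%:R * tau0 ^+ mu_size mu in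
  exists q : nat -> mpoly.mpoly k R,
    (forall m, (mpoly.msize (q m) <= m.+1)%N) /\
    forall z, in_box z ->
      (forall m, (m < N)%N -> `|box_eval z (q m)| <= G * (j%:R * tau) ^+ m) /\
      `|multi_partial mu f (mixed_point j z) - \sum_(m < N) box_eval z (q m)| <=
        G * (j%:R * tau) ^+ N.
Proof.
have tau_ge0 : 0 <= tau by rewrite mulr_ge0.
elim: j mu N => [|j IH] mu N lej mu0 leN G.
  have G_ge0 : 0 <= G by rewrite mulr_ge0 ?exprn_ge0.
  have prefix0 z : mixed_point 0 z = c by apply/rowP => i; rewrite mxE.
  have Gc : `|multi_partial mu f c| <= G.
    by apply: bound => //; apply: leq_trans leN; apply: leq_addl.
  exists (fun m => if m is 0%N then mpoly.mpolyC k (multi_partial mu f c) else 0).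
  split=> [[|m]|z _]; [by rewrite mpoly.msizeC; case: eqP|by rewrite mpoly.msize0|].
  split=> [[|m] _|]; rewrite ?mul0r ?expr0 ?mulr1 /box_eval.
  - by rewrite mpoly.mevalC.
  - by rewrite mpoly.meval0 normr0 mulr_ge0 // expr0n.
  rewrite prefix0; case: N leN => [|N] leN; first by rewrite big_ord0 subr0 expr0 mulr1.
  rewrite big_ord_recl mpoly.mevalC big1 ?addr0 ?subrr; last first.
    by move=> i _; rewrite lift0 mpoly.meval0.
  by rewrite normr0 expr0n mulr0.
pose jo : 'I_k := Ordinal lej.
have mujo : mu jo = 0%N by apply: mu0; rewrite /= ltnS.
have /choice[q qP] : forall m : nat, exists q : nat -> mpoly.mpoly k R, (m <= N)%N ->
    (forall l, (mpoly.msize (q l) <= l.+1)%N) /\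
    forall z, in_box z ->
      (forall l, (l < N - m)%N -> `|box_eval z (q l)| <=
         G * (m`!)%:R * tau0 ^+ m * (j%:R * tau) ^+ l) /\
      `|multi_partial (mu_add mu jo m) f (mixed_point j z) -
          \sum_(l < N - m) box_eval z (q l)| <=
        G * (m`!)%:R * tau0 ^+ m * (j%:R * tau) ^+ (N - m).
  move=> m; have [lem|] := leqP m N; last by exists (fun=> 0).
  have [|||q [q1 q2]] := IH (mu_add mu jo m) (N - m)%N.
  - exact: ltnW.
  - move=> i ij; rewrite /mu_add mu0 ?(ltn_trans ij) //.
    by rewrite -val_eqE /= ltn_eqF.
  - by rewrite mu_size_add; lia.
  have GE : (mu_fact (mu_add mu jo m))%:R * tau0 ^+ mu_size (mu_add mu jo m) =
      G * (m`!)%:R * tau0 ^+ m.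
    by rewrite mu_fact_add // mu_size_add natrM exprD /G; ring.
  by exists q => _; split=> // z zbox; rewrite -GE; apply: q2.
pose Xj : mpoly.mpoly k R := mpoly.mpolyX R (mpoly.mnm1 jo).
pose Q M := if (M < N)%N then
  \sum_(m < M.+1) ((m`!)%:R^-1 : R) *: (q m (M - m)%N * Xj ^+ m) else 0.
have msizeX m : (mpoly.msize (Xj ^+ m) <= m.+1)%N.
  elim: m => [|m IHm]; first by rewrite expr0 mpoly.msize1.
  rewrite exprS -[m.+1]add1n; apply: msizeM_leq => //.
  by rewrite mpoly.msizeX mpoly.mdeg1.
exists Q; split=> [M|z zbox].
  rewrite /Q; case: ltnP => [ltM|_]; last by rewrite mpoly.msize0.
  apply: msize_sum_leq => m; apply: leq_trans (mpoly.msizeZ_le _ _) _.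
  have lem : (m <= M)%N by rewrite -ltnS.
  rewrite -[X in (_ <= X.+1)%N](subnK lem); apply: msizeM_leq => //.
  by have [] := qP m (ltnW (leq_ltn_trans lem ltM)).
pose h := z ord0 jo - c ord0 jo.
have hr : `|h| <= r by apply: zbox.2.
pose a m l := h ^+ m / (m`!)%:R * box_eval z (q m l).
have QE M : (M < N)%N -> box_eval z (Q M) = \sum_(m < M.+1) a m (M - m)%N.
  rewrite /Q => ->; rewrite /box_eval raddf_sum; apply: eq_bigr => m _.
  rewrite /= mpoly.mevalZ mpoly.mevalM rmorphXn /= -!/(box_eval _ _) box_evalX -/h.
  by rewrite /a; ring.
have fact_neq0 m : (m`!)%:R != 0 :> R by rewrite pnatr_eq0 -lt0n fact_gt0.
have G_ge0 : 0 <= G by rewrite mulr_ge0 ?exprn_ge0.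
have jtau_ge0 : 0 <= j%:R * tau by rewrite mulr_ge0.
have coef_le m (b y : R) : 0 <= b -> `|y| <= G * (m`!)%:R * tau0 ^+ m * b ->
    `|h ^+ m / (m`!)%:R * y| <= G * (tau ^+ m * b).
  move=> b0 xb; rewrite normrM normrM normrX normfV [`|(_`!)%:R|]ger0_norm //.
  have -> : G * (tau ^+ m * b) =
      r ^+ m / (m`!)%:R * (G * (m`!)%:R * tau0 ^+ m * b).
    rewrite /tau exprMn; field; exact: fact_neq0.
  apply: ler_pM => //.
  by rewrite ler_wpM2r ?invr_ge0 // lerXn2r ?nnegrE.
have tauS M : G * \sum_(m < M.+1) tau ^+ m * (j%:R * tau) ^+ (M - m) <=
    G * (j.+1%:R * tau) ^+ M.
  apply: ler_wpM2l => //; apply: le_trans (sum_expr_le _ _ _) _ => //.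
  by rewrite -natr1 mulrDl mul1r addrC.
split=> [M ltM|].
  rewrite QE //; apply: le_trans (ler_norm_sum _ _ _) _.
  apply: le_trans (tauS M); rewrite big_distrr; apply: ler_sum => m _ /=.
  have lem : (m <= M)%N by rewrite -ltnS.
  apply: coef_le; first by rewrite exprn_ge0.
  have [_ /(_ z zbox)[qM _]] := qP m (ltnW (leq_ltn_trans lem ltM)).
  by apply: qM; rewrite ltn_sub2r // (leq_ltn_trans lem).
have prefS : mixed_point j.+1 z = h *: 'e_jo + mixed_point j z.
  apply/rowP => i; rewrite !mxE eqxx /= ltnS leq_eqVlt -[(i : nat) == j]/(i == jo).
  case: eqVneq => [->|] /=; last by rewrite mulr0 add0r.
  by rewrite ltnn mulr1 /h subrK.
have step : `|multi_partial mu f (mixed_point j.+1 z) -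
    \sum_(m < N) multi_partial (mu_add mu jo m) f (mixed_point j z) * h ^+ m / (m`!)%:R|
    <= G * tau ^+ N.
  rewrite prefS; apply: le_trans (taylor_coord _ leN _) _.
  - by move=> i; rewrite /= -ltnS; apply: mu0.
  - move=> t t01 i; rewrite !mxE eqxx /=.
    have [cz ci] := (zbox.1 i, cube_c i).
    have [cz' ci'] := (zbox.1 jo, cube_c jo).
    have [->|ij] := eqVneq i jo; last by rewrite mulr0 add0r; case: ifP.
    rewrite /= ltnn mulr1 /h.
    move: cz' ci' t01 => /andP[z0 z1] /andP[c0 c1] /andP[t0 t1].
    by have [le|/ltW le] := leP (z ord0 jo) (c ord0 jo); apply/andP; split; nra.
  by rewrite ler_wpM2l // lerXn2r ?nnegrE ?mulr_ge0 // ler_wpM2l.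
under eq_bigr => M _ do rewrite QE //.
rewrite sum_triangle.
apply: le_trans (tauS N); rewrite big_ord_recr /= subnn expr0 mulr1 mulrDr [X in _ <= X]addrC.
set g := multi_partial mu f (mixed_point j.+1 z) in step *.
set S := \sum_(m < N) _ in step.
rewrite -[g](subrK S) -addrA; apply: le_trans (ler_normD _ _) _; apply: lerD => //.
rewrite /S -sumrB; apply: le_trans (ler_norm_sum _ _ _) _.
rewrite big_distrr; apply: ler_sum => m _ /=.
have -> : multi_partial (mu_add mu jo m) f (mixed_point j z) * h ^+ m / (m`!)%:R -
    \sum_(l < N - m) a m l = h ^+ m / (m`!)%:R *
    (multi_partial (mu_add mu jo m) f (mixed_point j z) - \sum_(l < N - m) box_eval z (q m l)).
  by rewrite mulrBr big_distrr /= mulrAC mulrC; congr (_ - _); ring.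
apply: coef_le; first by rewrite exprn_ge0.
by have [_ /(_ z zbox)[]] := qP m (ltnW (ltn_ord m)).
Qed.

End TaylorCube.

(** * Polynomial approximation of products *)

Section TaylorModel.
Variables (R : realType) (k : nat) (c : 'rV[R]_k) (r : R).
Variables (beta : nat) (tau : R).
Hypothesis tau_ge0 : 0 <= tau.
Implicit Types F : 'rV[R]_k -> R.

(** On the box, [F z] is the value at 1 of a polynomial [W] whose coefficients
    decrease geometrically; those of index less than [beta] are polynomials in
    [z], so that truncating [W] approximates [F]. *)
Definition taylor_model (s : nat) F := exists q : nat -> mpoly.mpoly k R,
  (forall m, (mpoly.msize (q m) <= m.+1)%N) /\
  forall z, in_box c r z -> exists W : {poly R}, [/\ W.[1] = F z,
    forall m, `|W`_m| <= (s%:R * tau) ^+ m &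
    forall m, (m < beta)%N -> W`_m = box_eval c z (q m)].

Lemma taylor_model1 : taylor_model 0 (fun=> 1).
Proof.
exists (fun m => if m is 0%N then 1 else 0); split=> [[|m]|z _].
- by rewrite mpoly.msize1.
- by rewrite mpoly.msize0.
exists 1; split=> [|m|[|m] _]; rewrite ?hornerC // coefC.
- by case: m => [|m]; rewrite /= ?normr1 ?normr0 mul0r ?expr0 // expr0n.
- by rewrite /box_eval mpoly.meval1.
- by rewrite /box_eval mpoly.meval0.
Qed.

Lemma taylor_modelM s t F G : taylor_model s F -> taylor_model t G ->
  taylor_model (s + t) (fun z => F z * G z).
Proof.
move=> [p [psize pP]] [q [qsize qP]].
exists (fun m => \sum_(i < m.+1) p i * q (m - i)%N); split=> [m|z zbox].
  apply: msize_sum_leq => i; rewrite -[X in (_ <= X.+1)%N](subnKC (leq_ord i)).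
  exact: msizeM_leq.
have [W [W1 Wle Wp]] := pP z zbox; have [Y [Y1 Yle Yq]] := qP z zbox.
exists (W * Y); split; first by rewrite hornerM W1 Y1.
  move=> m; rewrite coefM; apply: le_trans (ler_norm_sum _ _ _) _.
  rewrite natrD mulrDl; apply: le_trans (sum_expr_le _ _ _); rewrite ?mulr_ge0 //.
  by apply: ler_sum => i _; rewrite normrM ler_pM.
move=> m ltm; rewrite coefM /box_eval raddf_sum; apply: eq_bigr => i _.
rewrite /= mpoly.mevalM Wp ?Yq //; first exact: leq_ltn_trans (leq_subr _ _) ltm.
by apply: leq_ltn_trans ltm; rewrite -ltnS.
Qed.

Lemma taylor_modelX s F e : taylor_model s F -> taylor_model (e * s) (fun z => F z ^+ e).
Proof.
move=> Fm; elim: e => [|e IH].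
  have -> : (fun z => F z ^+ 0) = fun=> 1 by apply/funext => z; rewrite expr0.
  exact: taylor_model1.
have -> : (fun z => F z ^+ e.+1) = fun z => F z * F z ^+ e.
  by apply/funext => z; rewrite exprS.
exact: taylor_modelM.
Qed.

Lemma taylor_model_prod (I : Type) (w : seq I) (s : I -> nat) (F : I -> 'rV[R]_k -> R) :
  (forall i, taylor_model (s i) (F i)) ->
  taylor_model (\sum_(i <- w) s i) (fun z => \prod_(i <- w) F i z).
Proof.
move=> Fm; elim: w => [|i w IH].
  rewrite big_nil; have -> : (fun z => \prod_(i <- [::]) F i z) = fun=> 1.
    by apply/funext => z; rewrite big_nil.
  exact: taylor_model1.
rewrite big_cons; have -> : (fun z => \prod_(j <- i :: w) F j z) =
    fun z => F i z * \prod_(j <- w) F j z.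
  by apply/funext => z; rewrite big_cons.
exact: taylor_modelM.
Qed.

Lemma geometric_le2 (x : R) n : 0 <= x <= 2^-1 -> \sum_(i < n) x ^+ i <= 2.
Proof.
move=> /andP[x0 x2]; suff : \sum_(i < n) x ^+ i <= 2 - 2 * x ^+ n.
  by move=> /le_trans; apply; rewrite gerBl mulr_ge0 ?exprn_ge0.
elim: n => [|n IH]; first by rewrite big_ord0 expr0 mulr1 subrr.
rewrite big_ord_recr exprS /=; have := exprn_ge0 n x0; nra.
Qed.

Lemma taylor_model_approx s F (delta : R) : taylor_model s F ->
  s%:R * tau <= delta -> delta <= 2^-1 ->
  exists p : mpoly.mpoly k R, (mpoly.msize p <= beta)%N /\
    forall z, in_box c r z -> `|F z - box_eval c z p| <= 2 * delta ^+ beta.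
Proof.
move=> [q [qsize qP]] led led2.
have d0 : 0 <= delta by apply: le_trans led; rewrite mulr_ge0.
exists (\sum_(m < beta) q m); split.
  by apply: msize_sum_leq => m; apply: leq_trans (qsize _) _.
move=> z zbox; have [W [<- Wle Wq]] := qP z zbox.
have -> : box_eval c z (\sum_(m < beta) q m) = \sum_(m < beta) W`_m.
  by rewrite /box_eval raddf_sum; apply: eq_bigr => m _; rewrite Wq.
rewrite (@horner_coef_wide _ (beta + size W)) ?leq_addl //.
rewrite big_split_ord /=.
rewrite (eq_bigr (fun i : 'I_beta => W`_i)); last by move=> i _; rewrite expr1n mulr1.
rewrite [X in X - _]addrC addrK; apply: le_trans (ler_norm_sum _ _ _) _.
apply: le_trans (_ : \sum_(i < size W) delta ^+ beta * delta ^+ i <= _).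
  apply: ler_sum => i _; rewrite expr1n mulr1 -exprD; apply: le_trans (Wle _) _.
  by apply: lerXn2r; rewrite ?nnegrE ?mulr_ge0.
rewrite -big_distrr /= [X in X <= _]mulrC; apply: ler_wpM2r; first exact: exprn_ge0.
by apply: geometric_le2; rewrite d0.
Qed.

End TaylorModel.

(** The coefficients of [W] are the homogeneous parts of the Taylor polynomial,
    and the remainder is put in degree [beta]. *)
Lemma taylor_model_mild (R : realType) k (f : 'rV[R]_k -> R) (c : 'rV[R]_k)
    (r : R) beta (tau0 : R) :
  smooth_on_cube f -> 0 <= tau0 -> 0 <= r -> unit_cube c ->
  (forall mu z, unit_cube z -> (mu_size mu <= beta)%N ->
    `|multi_partial mu f z| <= (mu_fact mu)%:R * tau0 ^+ mu_size mu) ->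
  taylor_model c r beta (k%:R * (tau0 * r)) 1 f.
Proof.
move=> smooth tau0_ge0 r_ge0 cube_c bound.
pose mu0 : 'I_k -> nat := fun=> 0%N.
have size0 : mu_size mu0 = 0%N by rewrite /mu_size big1.
have fact0 : mu_fact mu0 = 1%N by rewrite /mu_fact big1.
have part0 : multi_partial mu0 f = f.
  rewrite /multi_partial (_ : flatten _ = [::]) //.
  by elim: (enum 'I_k) => //= i s ->.
have [||q] := @taylor_prefix R k f smooth beta tau0 tau0_ge0 bound c r cube_c r_ge0
  k mu0 beta (leqnn k); first by [].
  by rewrite size0 addn0.
rewrite size0 fact0 expr0 mulr1 part0 => -[qsize qP]; exists q; split=> // z zbox.
have [qle] := qP z zbox; rewrite mul1r.
have -> : mixed_point c k z = z by apply/rowP => i; rewrite mxE ltn_ord.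
set rho := f z - _ => rho_le.
exists (\poly_(m < beta) box_eval c z (q m) + rho *: 'X^beta); split.
- rewrite hornerD hornerZ hornerXn expr1n mulr1 horner_poly.
  rewrite /rho [X in X + _](_ : _ = \sum_(m < beta) box_eval c z (q m)).
    by rewrite addrC subrK.
  by apply: eq_bigr => i _; rewrite expr1n mulr1.
- move=> m; rewrite coefD coef_poly coefZ coefXn mul1r.
  have [ltm|lem] := ltnP m beta.
    by rewrite ltn_eqF // mulr0 addr0 -[X in _ <= X]mul1r; apply: qle.
  rewrite add0r; case: eqVneq => [->|_]; first by rewrite mulr1.
  by rewrite mulr0 normr0 exprn_ge0 // !mulr_ge0.
- by move=> m ltm; rewrite coefD coef_poly ltm coefZ coefXn ltn_eqF // mulr0 addr0.
Qed.

(** * One small box *)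

(** The polynomial parts of the entries factor through the space with basis the
    monomials of degree less than [beta] in the parameters. *)
Lemma det_monomials_upper_bound (R : realType) k n (c : 'rV[R]_k) (r tau delta : R)
    beta D L (F : 'I_n -> 'rV[R]_k -> R) (e : 'I_L -> 'I_n -> nat)
    (z : 'I_L -> 'rV[R]_k) :
  0 <= tau -> D%:R * tau <= delta -> delta <= 2^-1 -> (0 < beta)%N ->
  (forall l, taylor_model c r beta tau 1 (F l)) ->
  (forall l x, unit_cube x -> `|F l x| <= 1) ->
  (forall j, (\sum_l e j l <= D)%N) -> (forall i, in_box c r (z i)) ->
  `|\det (\matrix_(i, j) \prod_l F l (z i) ^+ e j l)| <=
    4 ^+ L * (L`!)%:R * (2 * delta ^+ beta) ^+ (L - #|{: mpoly.bmultinom k beta}|).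
Proof.
move=> tau_ge0 led led2 beta0 Fm F1 eD zbox; set N := #|_|.
have d0 : 0 <= delta by apply: le_trans led; rewrite mulr_ge0.
have /choice[p pP] : forall j, exists p : mpoly.mpoly k R,
    (mpoly.msize p <= beta)%N /\ forall x, in_box c r x ->
    `|\prod_l F l x ^+ e j l - box_eval c x p| <= 2 * delta ^+ beta.
  move=> j; apply: (taylor_model_approx (s := (\sum_l e j l * 1)%N) tau_ge0 _ _ led2).
    by apply: taylor_model_prod => // l; apply: taylor_modelX.
  apply: le_trans led; apply: ler_wpM2r => //; rewrite ler_nat.
  by under eq_bigr do rewrite muln1.
have rho1 : 2 * delta ^+ beta <= 1.
  rewrite -(prednK beta0) exprS; apply: le_trans (_ : 2 * (delta * 1) <= _).
    rewrite ler_wpM2l // ler_wpM2l // exprn_ile1 //.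
    by apply: le_trans led2 _; rewrite invf_le1 ?ler1n.
  lra.
have rho0 : 0 <= 2 * delta ^+ beta by rewrite mulr_ge0 ?exprn_ge0.
pose U : 'M[R]_(L, N) := \matrix_(i, m)
  \prod_l (z i ord0 l - c ord0 l) ^+ (mpoly.bmnm (enum_val m) : mpoly.multinom k) l.
pose V : 'M[R]_(N, L) := \matrix_(m, j)
  mpoly.mcoeff (mpoly.bmnm (enum_val m)) (p j).
have UV i j : (U *m V) i j = box_eval c (z i) (p j).
  rewrite /box_eval {1}(mpoly.mpolywE (pP j).1) raddf_sum /= mxE.
  rewrite [RHS](reindex (fun m : 'I_N => enum_val m)) /=; last first.
    by exists enum_rank => m _; [exact: enum_valK|exact: enum_rankK].
  by apply: eq_bigr => m _; rewrite !mxE mpoly.mevalZ mpoly.mevalX mulrC.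
have mono1 i j : `|\prod_l F l (z i) ^+ e j l| <= 1.
  rewrite normr_prod; apply: prodr_ile1 => l _; rewrite normr_ge0 normrX exprn_ile1 //.
  by apply: F1; case: (zbox i).
set B := \matrix_(i, j) _.
rewrite -[B](subrK (U *m V)) [B - _ + _]addrC.
apply: det_perturbed_low_rank => [|i j|i j]; first by rewrite rho0.
  rewrite UV -[X in `|X|](subKr (\prod_l F l (z i) ^+ e j l)).
  apply: le_trans (ler_normB _ _) _; rewrite -[2]/(1 + 1); apply: lerD => //.
  by apply: le_trans rho1; apply: (pP j).2.
have -> : (B - U *m V) i j = \prod_l F l (z i) ^+ e j l - (U *m V) i j by rewrite !mxE.
by rewrite UV; apply: (pP j).2.
Qed.

Lemma hyperplane_hypersurface (R : realType) n (l : 'I_n) (a D : R) : 1 <= D ->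
  hypersurface_le D [set x : 'rV[R]_n | x ord0 l = a].
Proof.
move=> D1; exists (mpoly.mpolyX R (mpoly.mnm1 l) - mpoly.mpolyC n a).
set p := _ - _.
have p_lt : (1 < mpoly.msize p)%N.
  rewrite -(mpoly.mdeg1 l); apply: mpoly.msize_mdeg_lt.
  rewrite mpoly.mcoeff_msupp mpoly.mcoeffB mpoly.mcoeffX mpoly.mcoeffC eqxx.
  by rewrite mpoly.mnm1_eq0 mulr0 subr0 oner_eq0.
have p_le : (mpoly.msize p <= 2)%N.
  apply: leq_trans (mpoly.msizeD_le _ _) _.
  by rewrite geq_max mpoly.msizeX mpoly.mdeg1 mpoly.mmeasureN mpoly.msizeC; case: eqP.
have -> : mpoly.msize p = 2%N by apply/anti_leq/andP.
split=> //; rewrite /p; apply/seteqP; split=> x /=.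
  by move=> <-; rewrite mpoly.mevalB mpoly.mevalXU mpoly.mevalC subrr.
by rewrite mpoly.mevalB mpoly.mevalXU mpoly.mevalC => /eqP; rewrite subr_eq0 => /eqP.
Qed.

(** A nonzero linear relation between the values of all monomials of degree at
    most [D] is a hypersurface. *)
Lemma vanishing_hypersurface (R : realType) n D (S : set 'rV[R]_n) :
  (0 < n)%N -> (0 < D)%N ->
  (forall x : 'I_#|{: mpoly.bmultinom n D.+1}| -> 'rV[R]_n, (forall i, S (x i)) ->
    \det (\matrix_(i, j) \prod_l x i ord0 l ^+
      (mpoly.bmnm (enum_val j) : mpoly.multinom n) l) = 0) ->
  exists H, hypersurface_le D%:R H /\ S `<=` H.
Proof.
move=> n0 D0 detS; set L := #|_| in detS.
pose mono (x : 'rV[R]_n) (j : 'I_L) :=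
  \prod_l x ord0 l ^+ (mpoly.bmnm (enum_val j) : mpoly.multinom n) l.
have [B BS|b b0 bS] := @exists_vanishing_form R L
    [set v | exists2 x, S x & v = \row_j mono x j].
  have /choice[x xP] : forall i, exists x, S x /\ row i B = \row_j mono x j.
    by move=> i; have [x Sx Bx] := BS i; exists x.
  rewrite -(detS x) => [|i]; last by have [] := xP i.
  congr (\det _); apply/matrixP => i j; have [_ /rowP/(_ j)] := xP i.
  by rewrite !mxE.
pose p : mpoly.mpoly n R := \sum_(m : mpoly.bmultinom n D.+1)
  b (enum_rank m) ord0 *: mpoly.mpolyX R (mpoly.bmnm m).
have p_eval (x : 'rV[R]_n) : mpoly.meval (fun i => x ord0 i) p = \sum_j mono x j * b j ord0.
  rewrite raddf_sum [LHS](reindex (fun m : 'I_L => enum_val m)) /=; last first.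
    by exists enum_rank => m _; [exact: enum_valK|exact: enum_rankK].
  by apply: eq_bigr => j _; rewrite enum_valK mpoly.mevalZ mpoly.mevalX mulrC.
have p_S (x : 'rV[R]_n) : S x -> mpoly.meval (fun i => x ord0 i) p = 0.
  move=> Sx; have := bS (\row_j mono x j) (ex_intro2 _ _ x Sx erefl).
  move=> /matrixP/(_ ord0 ord0); rewrite !mxE => e; rewrite p_eval -[RHS]e.
  by apply: eq_bigr => j _; rewrite !mxE.
have p_size : (mpoly.msize p <= D.+1)%N.
  apply: msize_sum_leq => m; apply: leq_trans (mpoly.msizeZ_le _ _) _.
  by rewrite mpoly.msizeX mpoly.bmdeg.
have p0 : p != 0.
  apply: contraNneq b0 => p0; apply/eqP/colP => j; rewrite mxE.
  have := congr1 (mpoly.mcoeff (mpoly.bmnm (enum_val j))) p0.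
  rewrite mpoly.mcoeff0 raddf_sum (bigD1 (enum_val j)) //= mpoly.mcoeffZ mpoly.mcoeffX.
  rewrite eqxx mulr1 enum_valK big1 ?addr0 // => m mj.
  by rewrite mpoly.mcoeffZ mpoly.mcoeffX -mpoly.bmeqP (negPf mj) mulr0.
have [p1|p1] := ltnP 1 (mpoly.msize p).
  exists [set x | mpoly.meval (fun i => x ord0 i) p = 0]; split=> //.
  by exists p; split=> //; rewrite ler_nat -ltnS prednK // (ltn_trans _ p1).
(* A nonzero constant vanishes nowhere, so that [S] is empty. *)
exists [set x | x ord0 (Ordinal n0) = 0]; split.
  by apply: hyperplane_hypersurface; rewrite ler1n.
have pC := mpoly.msize1_polyC p1.
move=> x /p_S; rewrite pC mpoly.mevalC => e.
by move: p0; rewrite pC e mpoly.mpolyC0 eqxx.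
Qed.

Lemma le_tuple_height (R : realType) (K : fieldExtType rat) n (y : 'rV[K]_n) l (T : R) :
  tuple_height R y <= T -> weil_height R (y ord0 l) <= T.
Proof. by apply: le_trans; apply: le_bigmax. Qed.

(** The upper and the lower bounds for the determinant of the monomials at
    points of small height of one box contradict each other unless the
    determinant vanishes. *)
Lemma box_hypersurface (R : realType) (K : fieldExtType rat)
    (iota : {rmorphism K -> R}) (T : R) k n (c : 'rV[R]_k) (r tau delta : R)
    beta D (Phi : 'rV[R]_k -> 'rV[R]_n) :
  1 <= T -> (0 < n)%N -> (0 < D)%N ->
  0 <= tau -> D%:R * tau <= delta -> delta <= 2^-1 -> (0 < beta)%N ->
  (forall l, taylor_model c r beta tau 1 (fun z => Phi z ord0 l)) ->
  (forall l x, unit_cube x -> `|Phi x ord0 l| <= 1) ->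
  let L := #|{: mpoly.bmultinom n D.+1}| in
  let d := \dim {:K} in
  4 ^+ L * (L`!)%:R * (2 * delta ^+ beta) ^+ (L - #|{: mpoly.bmultinom k beta}|) *
    (L`!)%:R ^+ d * T ^+ (d ^ 2 * D * (L * n)) < 1 ->
  exists H, hypersurface_le D%:R H /\
    forall z, in_box c r z -> points_of_height iota setT T (Phi z) -> H (Phi z).
Proof.
move=> T1 n0 D0 tau0 led led2 beta0 Phim Phi1 L d small.
pose S : set 'rV[R]_n := [set x | exists2 z, in_box c r z &
  x = Phi z /\ points_of_height iota setT T x].
have [x xS|H [HD SH]] := @vanishing_hypersurface R n D S n0 D0; last first.
  by exists H; split=> // z zbox zT; apply: SH; exists z.
have /choice[z zP] : forall i, exists z, in_box c r z /\ x i = Phi z.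
  by move=> i; have [z zb [xz _]] := xS i; exists z.
have /choice[y yP] : forall i, exists y : 'rV[K]_n, x i = map_mx iota y /\ tuple_height R y <= T.
  by move=> i; have [_ _ [_ [_ [y yT yx]]]] := xS i; exists y.
pose e (j : 'I_L) l := (mpoly.bmnm (enum_val j) : mpoly.multinom n) l.
have esum j : (\sum_l e j l <= D)%N.
  by rewrite -ltnS -[X in (X < _)%N]mpoly.mdegE mpoly.bmdeg.
have eD j l : (e j l <= D)%N.
  by apply: leq_trans (esum j); rewrite (bigD1 l) //= leq_addr.
set B := \matrix_(i, j) _.
have BK : B = map_mx iota (\matrix_(i, j) \prod_l y i ord0 l ^+ e j l).
  apply/matrixP => i j; rewrite !mxE rmorph_prod; apply: eq_bigr => l _.
  by rewrite (yP i).1 mxE rmorphXn.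
have Bup := det_monomials_upper_bound (e := e) (z := z) tau0 led led2 beta0 Phim Phi1 esum
  (fun i => (zP i).1).
rewrite (_ : \matrix_(i, j) _ = B) in Bup; last first.
  by apply/matrixP => i j; rewrite !mxE; apply: eq_bigr => l _; rewrite (zP i).2.
apply/eqP; rewrite BK det_map_mx fmorph_eq0; apply/negP => /negP delta0.
have := det_monomials_lower_bound iota T1
  (fun p l => le_tuple_height l (yP p).2) eD delta0.
rewrite -det_map_mx -BK leNgt => /negP; apply; apply: le_lt_trans small.
by do 2![apply: ler_wpM2r; first by rewrite exprn_ge0 // (le_trans ler01)].
Qed.

(** * Choice of the parameters *)

Lemma card_multinom_upper k b : (#|{: mpoly.bmultinom k b}| <= b ^ k)%N.
Proof.
have -> : (b ^ k = #|{ffun 'I_k -> 'I_b}|)%N by rewrite card_ffun !card_ord.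
have lt (m : mpoly.bmultinom k b) (i : 'I_k) : ((mpoly.bmnm m : mpoly.multinom k) i < b)%N.
  apply: leq_ltn_trans (mpoly.bmdeg m); rewrite mpoly.mdegE (bigD1 i) //= leq_addr //.
apply: (@leq_card _ _ (fun m => [ffun i => Ordinal (lt m i)])) => m1 m2 /ffunP e.
apply/val_inj/mpoly.mnmP => i; have := e i; rewrite !ffunE => /(congr1 val).
exact.
Qed.

(** All exponents up to [D / n] are possible independently. *)
Lemma card_multinom_lower n D : (0 < n)%N ->
  (D ^ n <= #|{: mpoly.bmultinom n D.+1}| * n ^ n)%N.
Proof.
move=> n0; pose q := (D %/ n)%N.
have le : (q.+1 ^ n <= #|{: mpoly.bmultinom n D.+1}|)%N.
  have -> : (q.+1 ^ n = #|{ffun 'I_n -> 'I_q.+1}|)%N by rewrite card_ffun !card_ord.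
  pose m (g : {ffun 'I_n -> 'I_q.+1}) : mpoly.multinom n :=
    mpoly.Multinom [tuple nat_of_ord (g i) | i < n].
  have mE g i : m g i = g i.
    by rewrite [LHS]tnth_mktuple.
  have lt g : (mpoly.mdeg (m g) < D.+1)%N.
    rewrite mpoly.mdegE ltnS; apply: leq_trans (_ : \sum_(i < n) q <= _)%N.
      by apply: leq_sum => i _; rewrite mE -ltnS.
    by rewrite sum_nat_const card_ord mulnC leq_trunc_div.
  apply: (@leq_card _ _ (fun g => mpoly.BMultinom (lt g))) => g1 g2 /(congr1 (@mpoly.bmnm _ _)) /= e.
  apply/ffunP => i; apply: val_inj; rewrite /= -!mE.
  by rewrite e.
apply: leq_trans (leq_mul le (leqnn _)); rewrite -expnMn.
by rewrite leq_exp2r // ltnW // ltn_ceil.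
Qed.

Lemma card_multinom_gt1 n D : (0 < n)%N -> (0 < D)%N ->
  (1 < #|{: mpoly.bmultinom n D.+1}|)%N.
Proof.
move=> n0 D0; pose l : 'I_n := Ordinal n0.
have lt0 : (mpoly.mdeg (mpoly.mnm0 (n := n)) < D.+1)%N by rewrite mpoly.mdeg0.
have lt1 : (mpoly.mdeg (mpoly.mnm1 l) < D.+1)%N by rewrite mpoly.mdeg1.
rewrite -card_bool.
apply: (@leq_card _ _ (fun b : bool => if b then mpoly.BMultinom lt1 else mpoly.BMultinom lt0)).
have ne : mpoly.mnm1 l != mpoly.mnm0 by rewrite mpoly.mnm1_eq0.
by move=> [] [] // /(congr1 (@mpoly.bmnm _ _)) /= e; rewrite ?e ?eqxx // -e eqxx in ne.
Qed.

Section ParameterChoice.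
Variable R : realType.

Lemma expR1_bounds : 2 <= expR (1 : R) <= 4.
Proof.
apply/andP; split; first by have := expR_ge1Dx (1 : R).
have h : expR (1 / 2) <= 2 :> R.
  rewrite -[expR _]invrK -expRN -[X in _ <= X]invrK lef_pV2 ?posrE ?expR_gt0 ?invr_gt0 //.
  by apply: le_trans (expR_ge1Dx _); lra.
rewrite [X in expR X](_ : 1 = 1 / 2 + 1 / 2); last by lra.
rewrite expRD; have := expR_gt0 (1 / 2 : R); nra.
Qed.

(** [D E <= kappa beta], and [delta = 4 ^ (- box_exponent)] is small enough for
    the two bounds of the determinant to be contradictory. *)
Definition kappa (n : nat) : nat := (2 ^ n.+1 * n ^ n)%N.
Definition box_exponent (n : nat) : nat := (6 * (n * kappa n) + 6)%N.

(** [2 beta ^ k] is close to the number [L] of monomials, which is of the order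
    of [D ^ n]; and [D] is about [E ^ (k / (n - k))]. *)
Lemma degree_order k n D L beta (E : R) : (0 < k)%N -> (k < n)%N -> (0 < D)%N ->
  (0 < beta)%N -> 0 <= E -> E ^+ k <= (2 * D)%:R ^+ (n - k) ->
  (D ^ n <= L * n ^ n)%N -> (L <= 2 * beta.+1 ^ k)%N ->
  D%:R * E <= (kappa n * beta)%:R.
Proof.
move=> k0 kn D0 b0 E0 ED DL Lb.
rewrite -(@ler_pXn2r _ k) ?nnegrE ?mulr_ge0 // exprMn.
apply: le_trans (_ : D%:R ^+ k * (2 * D)%:R ^+ (n - k) <= _).
  by rewrite ler_wpM2l ?exprn_ge0.
rewrite -!natrX -natrM ler_nat expnMn mulnCA -expnD subnKC; last exact: ltnW.
apply: leq_trans (leq_mul (leqnn _) DL) _.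
apply: leq_trans (_ : 2 ^ (n - k) * (2 * (2 * beta) ^ k * n ^ n) <= _)%N.
  rewrite leq_mul2l leq_mul2r; apply/orP; right; apply/orP; right.
  apply: leq_trans Lb _; rewrite leq_mul2l /= leq_exp2r //; lia.
rewrite expnMn [X in (_ <= X)%N]expnMn.
apply: leq_trans (_ : kappa n * beta ^ k <= _)%N; last first.
  by rewrite leq_mul2r; apply/orP; right; rewrite -{1}[kappa n]expn1 leq_pexp2l //
    /kappa muln_gt0 !expn_gt0 /= (leq_trans _ kn).
have e2n : (2 ^ n = 2 ^ (n - k) * 2 ^ k)%N by rewrite -expnD subnK // ltnW.
rewrite /kappa expnS e2n; apply/eq_leq.
by move: (2 ^ (n - k))%N (2 ^ k)%N (beta ^ k)%N (n ^ n)%N => w x y z; ring.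
Qed.

(** In exponential form, with [L! <= L ^ L <= exp (n D) ^ L], [4 <= exp 2] and
    [1 / 4 <= exp (- 1)], the logarithm of the left-hand side is at most
    [L * (5 / 2 + 3 n D E - box_exponent n * beta / 2)]. *)
Lemma contradictory_bounds n d D L N beta (T : R) (E := d%:R ^+ 2 * ln T) :
  (0 < d)%N -> (0 < D)%N -> (0 < beta)%N ->
  expR 1 <= T -> (0 < L)%N -> (L <= D.+1 ^ n)%N -> (2 * N <= L)%N ->
  D%:R * E <= (kappa n * beta)%:R ->
  4 ^+ L * (L`!)%:R * (2 * (4^-1 ^+ box_exponent n) ^+ beta) ^+ (L - N) *
    (L`!)%:R ^+ d * T ^+ (d ^ 2 * D * (L * n)) < 1.
Proof.
move=> d0 D0 b0 T1 L0 LD NL DE.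
have /andP[e2 e4] := expR1_bounds.
have T0 : 0 < T by apply: lt_le_trans T1; apply: expR_gt0.
have lnT : 1 <= ln T by rewrite -[1](expRK (1 : R)) ler_ln ?posrE ?expR_gt0.
have d1 : 1 <= d%:R :> R by rewrite ler1n.
have dE : d%:R <= E by rewrite /E expr2 -mulrA ler_peMr // mulr_ege1.
have TE : T ^+ (d ^ 2 * D * (L * n)) = expR (E * (n * D * L)%:R).
  rewrite -[T in LHS](lnK T0) -expRM_natl; congr expR; rewrite /E !natrM; ring.
have fact_le : (L`!)%:R <= expR (n * D * L)%:R :> R.
  have factX m : (m <= L)%N -> (m`! <= L ^ m)%N.
    by elim: m => // m IH ltm; rewrite factS expnS leq_mul // IH // ltnW.
  apply: le_trans (_ : ((D.+1 ^ n) ^ L)%:R <= _).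
    by rewrite ler_nat; apply: leq_trans (factX L (leqnn L)) _; rewrite leq_exp2r.
  rewrite !natrX !natrM [n%:R * _]mulrC !expRM_natr.
  apply: lerXn2r; rewrite ?nnegrE ?exprn_ge0 ?expR_ge0 //.
  apply: lerXn2r; rewrite ?nnegrE ?expR_ge0 //.
  by rewrite -natr1 addrC expR_ge1Dx.
have four_le : 4 ^+ L <= expR (2 * L%:R) :> R.
  rewrite expRM_natr lerXn2r ?nnegrE ?expR_ge0 //.
  by rewrite -[2]mulr1 expRM_natl expr2; nra.
have small_le : (2 * (4^-1 ^+ box_exponent n) ^+ beta) ^+ (L - N) <=
   expR ((1 - (box_exponent n * beta)%:R) * (L%:R / 2)) :> R.
  have base : 2 * (4^-1 ^+ box_exponent n) ^+ beta <=
      expR (1 - (box_exponent n * beta)%:R) :> R.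
    rewrite expRD expRN -[(_ * beta)%:R]mulr1 expRM_natl -exprM -exprVn.
    apply: ler_pM => //.
    by apply: lerXn2r; rewrite ?nnegrE ?invr_ge0 ?expR_ge0 // lef_pV2 ?posrE ?expR_gt0.
  apply: le_trans (_ : expR (1 - (box_exponent n * beta)%:R) ^+ (L - N) <= _).
    by apply: lerXn2r base; rewrite nnegrE ?expR_ge0 // mulr_ge0.
  rewrite -expRM_natr ler_expR; apply: ler_wnM2l.
    by rewrite subr_le0 ler1n muln_gt0 b0 /box_exponent addn_gt0 orbT.
  have LN : (L <= (L - N) * 2)%N by clear -NL; lia.
  by rewrite ler_pdivrMr // -natrM ler_nat.
rewrite TE; apply: le_lt_trans (_ : expR (2 * L%:R) * expR (n * D * L)%:R *
  expR ((1 - (box_exponent n * beta)%:R) * (L%:R / 2)) * expR (n * D * L)%:R ^+ d *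
  expR (E * (n * D * L)%:R) < 1).
  rewrite ler_wpM2r ?expR_ge0 //.
  apply: ler_pM; rewrite ?mulr_ge0 ?exprn_ge0 ?invr_ge0 //.
    apply: ler_pM; rewrite ?mulr_ge0 ?exprn_ge0 ?invr_ge0 //.
    by apply: ler_pM; rewrite ?exprn_ge0.
  by apply: lerXn2r; rewrite ?nnegrE ?expR_ge0.
rewrite -expRM_natl -!expRD -[X in _ < X]expR0 ltr_expR.
pose Y : R := (n * D * L)%:R; rewrite -!/Y; have Y0 : 0 <= Y by apply: ler0n.
have L1 : 1 <= L%:R :> R by rewrite ler1n.
have b1 : 1 <= beta%:R :> R by rewrite ler1n.
have EY : E * Y <= n%:R * (kappa n)%:R * beta%:R * L%:R.
  have -> : E * Y = n%:R * L%:R * (D%:R * E) by rewrite /Y !natrM; ring.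
  have -> : n%:R * (kappa n)%:R * beta%:R * L%:R = n%:R * L%:R * (kappa n * beta)%:R :> R.
    by rewrite natrM; ring.
  by rewrite ler_wpM2l // -natrM ler0n.
have dY : d%:R * Y <= E * Y by rewrite ler_wpM2r.
have Y1 : Y <= d%:R * Y by rewrite ler_peMl.
have bL : L%:R <= beta%:R * L%:R :> R by rewrite ler_peMl.
set P := _ * L%:R in EY.
have -> : (1 - (box_exponent n * beta)%:R) * (L%:R / 2) =
    L%:R / 2 - 3 * P - 3 * (beta%:R * L%:R) :> R.
  rewrite /P natrM /box_exponent natrD [(6 * _)%:R]natrM [(n * _)%:R]natrM.
  by field.
lra.
Qed.

End ParameterChoice.

Lemma leq_exp2r_weak m n e : (m <= n)%N -> (m ^ e <= n ^ e)%N.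
Proof. by case: e => [|e] lemn; rewrite ?expn0 // leq_exp2r. Qed.

Lemma exists_beta k L : (0 < k)%N -> (1 < L)%N -> exists beta,
  [/\ (0 < beta)%N, (2 * beta ^ k <= L)%N & (L <= 2 * beta.+1 ^ k)%N].
Proof.
move=> k0 L1; pose P b := (2 * b ^ k <= L)%N.
have exP : exists b, P b by exists 1%N; rewrite /P exp1n muln1.
have leP b : P b -> (b <= L)%N.
  rewrite /P; apply: leq_trans; apply: leq_trans (_ : b ^ k <= _)%N; last exact: leq_pmull.
  by case: b => // b; rewrite -{1}[b.+1]expn1 leq_pexp2l.
case: (ex_maxnP exP leP) => b Pb maxb; exists b; split=> //.
  by apply: maxb; rewrite /P exp1n muln1.
by apply: ltnW; rewrite ltnNge; apply/negP => /maxb; rewrite ltnn.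
Qed.

(** * Mild maps on small boxes *)

Section MildBounds.
Variables (R : realType) (k : nat) (A C : R) (f : 'rV[R]_k -> R).
Hypothesis mild : mild_bound A C f.

Lemma mild_bound0 z : unit_cube z -> `|f z| <= 1.
Proof.
move=> zc; have := mild (fun=> 0%N) zc; rewrite /multi_partial.
rewrite (_ : flatten _ = [::]); last by elim: (enum 'I_k) => //= i s ->.
by rewrite /= big1 // [(\sum__ _)%N]big1 // expr0 mulr1.
Qed.

Lemma mild_bound_nat (a c beta : nat) : (0 < k)%N -> A <= a%:R -> C <= c%:R ->
  forall mu z, unit_cube z -> (mu_size mu <= beta)%N ->
  `|multi_partial mu f z| <= (mu_fact mu)%:R * (a.+1 * beta ^ c)%:R ^+ mu_size mu.
Proof.
move=> k0 Aa Cc mu z zc leb; apply: le_trans (mild mu zc) _.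
rewrite -/(mu_size mu) -/(mu_fact mu); apply: ler_wpM2l => //.
have [->|m0] := posnP (mu_size mu); first by rewrite !expr0.
(* The derivative of order 1 shows that [A] is not negative. *)
have A0 : 0 <= A.
  pose i0 : 'I_k := Ordinal k0.
  have := mild (fun i => (i == i0 : nat)) zc.
  have -> : (\sum_i (i == i0))%N = 1%N.
    by rewrite (bigD1 i0) //= ?eqxx big1 // => i /negPf ->.
  have -> : (\prod_i (i == i0)`!)%N = 1%N by apply: big1 => i _; case: eqP.
  by rewrite /= !mulr1n powR1 mulr1 mul1r expr1; apply: le_trans.
apply: lerXn2r; rewrite ?nnegrE ?mulr_ge0 ?powR_ge0 // natrM; apply: ler_pM => //.
  by apply: le_trans Aa _; rewrite ler_nat.
have m1 : 1 <= (mu_size mu)%:R :> R by rewrite ler1n.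
apply: le_trans (ler_powR m1 Cc) _; rewrite powR_mulrn // -natrX ler_nat.
by apply: leq_exp2r_weak.
Qed.

End MildBounds.

(** The number [M] of boxes in each direction makes [D tau = delta]; it is at
    most [count_factor] times a power of [E]. *)
Definition count_factor (a c n k : nat) : nat :=
  (k * a.+1 * 2 ^ (n * c) * 4 ^ box_exponent n)%N.

Definition box_number (a c n k D beta : nat) : nat :=
  (D * k * (a.+1 * beta ^ c) * 4 ^ box_exponent n)%N.

Lemma box_number_le (R : realType) a c n k D beta (E : R) : 1 <= E -> D%:R <= E ^+ k ->
  (beta <= (2 * D) ^ n)%N ->
  (box_number a c n k D beta)%:R <= (count_factor a c n k)%:R * E ^+ (k + k * (n * c)).
Proof.
move=> E1 DE leb; have E0 : 0 <= E by apply: le_trans E1.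
have bE : (beta ^ c)%:R <= (2 ^ (n * c))%:R * E ^+ (k * (n * c)).
  apply: le_trans (_ : ((2 * D) ^ (n * c))%:R <= _).
    rewrite ler_nat expnM; exact: leq_exp2r_weak.
  rewrite expnMn natrM [(D ^ _)%:R]natrX [E ^+ _]exprM; apply: ler_wpM2l => //.
  by apply: lerXn2r; rewrite ?nnegrE ?exprn_ge0.
rewrite /box_number /count_factor exprD !natrM.
have -> : k%:R * a.+1%:R * (2 ^ (n * c))%:R * (4 ^ box_exponent n)%:R *
    (E ^+ k * E ^+ (k * (n * c))) =
  E ^+ k * k%:R * (a.+1%:R * ((2 ^ (n * c))%:R * E ^+ (k * (n * c)))) *
    (4 ^ box_exponent n)%:R by ring.
apply: ler_wpM2r => //; apply: ler_pM; rewrite ?mulr_ge0 //; first exact: ler_wpM2r.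
exact: ler_wpM2l.
Qed.

Definition box_center (R : realType) k M (g : {ffun 'I_k -> 'I_M}) : 'rV[R]_k :=
  \row_i (((g i)%:R + 2^-1) / M%:R).

Lemma cover_unit_cube (R : realType) k M (z : 'rV[R]_k) : (0 < M)%N -> unit_cube z ->
  exists g : {ffun 'I_k -> 'I_M},
    in_box (box_center R g) M%:R^-1 z.
Proof.
move=> M0 zc; have Mr : 0 < M%:R :> R by rewrite ltr0n.
have lt i : (Num.trunc (z ord0 i * M%:R) < M)%N.
  have /andP[z0 z1] := zc i.
  by rewrite truncn_lt_nat ?mulr_ge0 ?(ltW z0) // -[X in _ < X]mul1r ltr_pM2r.
exists [ffun i => Ordinal (lt i)]; split=> // i; rewrite !mxE ffunE /=.
have : 0 <= z ord0 i * M%:R by rewrite mulr_ge0 //; have /andP[/ltW] := zc i.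
move=> /trunc_itv; set t := Num.trunc _ => /andP[le1 lt1].
rewrite -(ler_pM2r Mr) mulVf ?gt_eqF // -{2}(ger0_norm (ltW Mr)) -normrM mulrBl.
rewrite mulfVK ?gt_eqF // ler_norml; move: lt1; rewrite -natr1 => lt1.
by apply/andP; split; lra.
Qed.

Lemma box_center_in_cube (R : realType) k M (g : {ffun 'I_k -> 'I_M}) :
  unit_cube (box_center R g).
Proof.
move=> i; rewrite mxE; have M0 : (0 < M)%N by case: (g i) => ? /(leq_trans _); apply.
have Mr : 0 < M%:R :> R by rewrite ltr0n.
apply/andP; split; first by rewrite divr_gt0 // ltr_wpDl // invr_gt0.
rewrite ltr_pdivrMr // mul1r; apply: lt_le_trans (_ : (g i).+1%:R <= _).
  by rewrite -[(g i).+1%:R]natr1 ltrD2l invf_lt1 // ltr1n.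
by rewrite ler_nat.
Qed.

(** * The hypersurfaces *)

(** One hypersurface for each of the [J] maps and each of the [M ^ k] boxes. *)
Lemma mild_hypersurfaces (R : realType) (J n k a c : nat) (A C : R) (X : set 'rV[R]_n)
    (K : fieldExtType rat) (iota : {rmorphism K -> R}) (T : R) :
  A <= a%:R -> C <= c%:R -> (0 < k)%N -> (k < n)%N ->
  mild_parametrization k J A C X -> expR 1 <= T ->
  let d : R := (\dim {:K})%:R in
  exists (N : nat) (H : 'I_N -> set 'rV[R]_n),
    [/\ N%:R <= (J * count_factor a c n k ^ k)%:R *
          (d ^+ 2 * ln T) ^+ ((k + k * (n * c)) * k),
        forall i, hypersurface_le ((d ^+ 2 * ln T) `^ (k%:R / (n - k)%:R)) (H i) &
        points_of_height iota X T `<=` \bigcup_i H i].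
Proof.
move=> Aa Cc k0 kn [Phi [Phi_mild XPhi]] T1 d; set E := d ^+ 2 * ln T.
have n0 : (0 < n)%N by apply: leq_trans kn.
have nk0 : (0 < n - k)%N by rewrite subn_gt0.
have dim0 : (0 < \dim {:K})%N by apply: adim_gt0.
have T0 : 0 < T by apply: lt_le_trans T1; apply: expR_gt0.
have lnT : 1 <= ln T by rewrite -[1](expRK (1 : R)) ler_ln ?posrE ?expR_gt0.
have T_ge1 : 1 <= T.
  by apply: le_trans T1; have /andP[+ _] := expR1_bounds R; apply: le_trans; rewrite ler1n.
have E1 : 1 <= E by apply: mulr_ege1 => //; apply: exprn_ege1; rewrite ler1n.
have E0 : 0 <= E by apply: le_trans E1.
set Dr := E `^ _; pose D := Num.trunc Dr.
have Dr1 : 1 <= Dr by rewrite -(powRr0 E) ler_powR // divr_ge0.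
have D0 : (0 < D)%N by rewrite truncn_gt0.
have /trunc_itv/andP[DleDr DrltD] : 0 <= Dr by apply: le_trans Dr1.
have D2 : (D.+1 <= 2 * D)%N by rewrite mul2n -addnn -addn1 leq_add2l.
have DEk : D%:R <= E ^+ k.
  apply: le_trans DleDr _; rewrite -powR_mulrn // ler_powR //.
  by rewrite ler_pdivrMr ?ltr0n // ler_peMr // ler1n.
have ED : E ^+ k <= (2 * D)%:R ^+ (n - k).
  have -> : E ^+ k = Dr ^+ (n - k).
    rewrite -[RHS]powR_mulrn ?powR_ge0 // -powRrM mulfVK ?pnatr_eq0 -?lt0n //.
    by rewrite powR_mulrn.
  apply: lerXn2r; rewrite ?nnegrE ?powR_ge0 //; apply: le_trans (ltW DrltD) _.
  by rewrite ler_nat.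
set L := #|{: mpoly.bmultinom n D.+1}|.
have L1 : (1 < L)%N by apply: card_multinom_gt1.
have [beta [beta0 bL Lb]] := exists_beta k0 L1.
have LD : (L <= D.+1 ^ n)%N by apply: card_multinom_upper.
have DE := degree_order k0 kn D0 beta0 E0 ED (card_multinom_lower D n0) Lb.
pose M := box_number a c n k D beta.
have M0 : (0 < M)%N by rewrite /M /box_number !muln_gt0 !expn_gt0 D0 k0 beta0.
pose delta : R := 4^-1 ^+ box_exponent n.
pose tau : R := k%:R * ((a.+1 * beta ^ c)%:R * M%:R^-1).
have M_neq0 : M%:R != 0 :> R by rewrite pnatr_eq0 -lt0n.
have led : D%:R * tau <= delta.
  have dM : delta * M%:R = (D * k * (a.+1 * beta ^ c))%:R.
    by rewrite /M /box_number natrM natrX /delta exprVn mulrC mulfK ?expf_neq0.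
  by rewrite /tau !mulrA ler_pdivrMr ?ltr0n // dM !natrM !mulrA.
have led2 : delta <= 2^-1.
  rewrite /delta /box_exponent addnS exprS; apply: le_trans (_ : 4^-1 * 1 <= _).
    by rewrite ler_wpM2l ?invr_ge0 // exprn_ile1 ?invr_ge0 // invf_le1 ?ler1n.
  by rewrite mulr1 lef_pV2 ?posrE // ler_nat.
have NL : (2 * #|{: mpoly.bmultinom k beta}| <= L)%N.
  by apply: leq_trans bL; rewrite leq_mul2l card_multinom_upper.
have small := contradictory_bounds dim0 D0 beta0 T1 (ltnW L1) LD NL DE.
have /choice[H HP] : forall jg : 'I_J * {ffun 'I_k -> 'I_M}, exists H,
    hypersurface_le D%:R H /\ forall z, in_box (box_center R jg.2) M%:R^-1 z ->
      points_of_height iota setT T (Phi jg.1 z) -> H (Phi jg.1 z).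
  move=> [j g]; apply: (@box_hypersurface R K iota T k n (box_center R g) M%:R^-1 tau delta beta D (Phi j)) => //.
  - by rewrite /tau !mulr_ge0.
  - move=> l; have [smooth mild] := Phi_mild j l.
    apply: taylor_model_mild => //.
      exact: box_center_in_cube.
    exact: mild_bound_nat mild _ _ _ k0 Aa Cc.
  - by move=> l x xc; have [_ mild] := Phi_mild j l; apply: (mild_bound0 mild).
exists #|{: 'I_J * {ffun 'I_k -> 'I_M}}|, (fun i => H (enum_val i)); split.
- rewrite card_prod card_ffun !card_ord !natrM -mulrA ler_wpM2l // !natrX exprM.
  rewrite -exprMn; apply: lerXn2r; rewrite ?nnegrE ?mulr_ge0 ?exprn_ge0 //.
  apply: box_number_le => //.
  apply: leq_trans (_ : L <= _)%N.
    apply: leq_trans bL; apply: leq_trans (_ : beta ^ k <= _)%N; last exact: leq_pmull.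
    by rewrite -{1}[beta]expn1 leq_pexp2l.
  by apply: leq_trans LD _; apply: leq_exp2r_weak.
- move=> i; have [[p [p1 pD ->]] _] := HP (enum_val i).
  by exists p; split=> //; apply: le_trans DleDr.
- move=> x [Xx hx]; have [j _ [z zc zx]] := XPhi x Xx.
  have [g zbox] := cover_unit_cube M0 zc.
  exists (enum_rank (j, g)) => //; rewrite enum_rankK -zx.
  by apply: (HP (j, g)).2 => //=; rewrite zx; split.
Qed.

(** [X] has at most [J] points. *)
Lemma mild_hypersurfaces0 (R : realType) (J n : nat) (A C : R) (X : set 'rV[R]_n) (D : R) :
  (0 < n)%N -> 1 <= D -> mild_parametrization 0 J A C X ->
  exists H : 'I_J -> set 'rV[R]_n,
    (forall i, hypersurface_le D (H i)) /\ X `<=` \bigcup_i H i.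
Proof.
move=> n0 D1 [Phi [_ XPhi]]; pose l : 'I_n := Ordinal n0.
exists (fun j => [set x | x ord0 l = Phi j 0 ord0 l]); split.
  by move=> i; apply: hyperplane_hypersurface.
move=> x /XPhi[j _ [z _ <-]]; exists j => //=.
by rewrite (_ : z = 0) //; apply/rowP => -[].
Qed.

Theorem theorem1 (R : realType) :
  exists c1 c2 c3 : 5.-tuple nat -> nat,
    [/\ recursive c1, recursive c2, recursive c3 &
    forall (J n k a c : nat) (A C : R) (X : set 'rV[R]_n),
      A <= a%:R -> C <= c%:R ->
      (k < n)%N ->
      X `<=` @unit_cube R n ->
      mild_parametrization k J A C X ->
      let par := [tuple J; a; c; n; k] in
      forall (K : fieldExtType rat) (iota : {rmorphism K -> R}) (T : R),
        expR 1 <= T ->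
        let d : R := (\dim {:K})%:R in
        exists (N : nat) (H : 'I_N -> set 'rV[R]_n),
          [/\ N%:R <= (c1 par)%:R * d ^+ c2 par * ln T ^+ c3 par,
              forall i, hypersurface_le ((d ^+ 2 * ln T) `^ (k%:R / (n - k)%:R))
                                        (H i) &
              points_of_height iota X T `<=` \bigcup_i H i]].
Proof.
(* The entries of [v] are [J], [a], [c], [n] and [k], in this order. *)
pose t (i : nat) (v : 5.-tuple nat) := tnth v (inord i).
pose e v := ((t 4 v + t 4 v * (t 3 v * t 2 v)) * t 4 v)%N.
pose c1 v := (t 0 v * count_factor (t 1 v) (t 2 v) (t 3 v) (t 4 v) ^ t 4 v)%N.
have rt i : recursive (t i) by apply: rec_proj.
have re : recursive e.
  by do !first [exact: rt | apply: recursive_add | apply: recursive_mul].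
exists c1, (fun v => 2 * e v)%N, e; split=> //.
- rewrite /c1 /count_factor /box_exponent /kappa.
  by do !first [exact: rt | exact: recursive_const | apply: recursive_succ
    | apply: recursive_add | apply: recursive_mul | apply: recursive_exp].
- by apply: recursive_mul => //; apply: recursive_const.
move=> J n k a c A C X Aa Cc kn _ XPhi par K iota T T1 d.
have [t0 t1 t2 t3 t4] : [/\ t 0%N par = J, t 1%N par = a, t 2%N par = c,
    t 3%N par = n & t 4%N par = k].
  by split; rewrite /t (tnth_nth 0%N) inordK.
have d1 : 1 <= d by rewrite ler1n adim_gt0.
rewrite /c1 /e t0 t1 t2 t3 t4; have [k0|k0] := posnP k.
  rewrite k0 in XPhi *.
  have [|H [HD XH]] := mild_hypersurfaces0 (D := (d ^+ 2 * ln T) `^ (0%:R / (n - 0)%:R))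
    (leq_ltn_trans (leq0n k) kn) _ XPhi.
    by rewrite mul0r powRr0.
  exists J, H; split=> //; last by move=> x [/XH].
  by rewrite muln0 !expr0 !mulr1 expn0 muln1.
have [N [H [NH HD XH]]] := mild_hypersurfaces iota Aa Cc k0 kn XPhi T1.
exists N, H; split=> //; apply: le_trans NH _.
by rewrite exprMn -exprM mulrA.
Qed.
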